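(* Finitely generated free abelian groups are dovetail right-angled Artin groups, all of whose standard geodesics are $\mathcal{F}$-geodesics.
   Context: For a finite simplicial graph $\Gamma$ with vertex set $V\Gamma$, the right-angled Artin group (RAAG) $A(\Gamma)$ has generating set $V\Gamma$ and relations $[v,w]=1$ for adjacent $v,w$ ($\mathbb{Z}^n$ is $A(\Gamma)$ for $\Gamma$ the complete graph on $n$ vertices). $X(\Gamma)$ is the universal cover of the Salvetti complex of $A(\Gamma)$ (one vertex, one loop per $v\in V\Gamma$, one $n$-torus per $n$-clique) with its CAT(0) metric; its 1-skeleton is the Cayley graph of $A(\Gamma)$. A standard geodesic is a line $l$ in the 1-skeleton whose vertex set $v(l)$ is a coset $g\langle w\rangle$, $w\in V\Gamma$; its label is $w$. $[A]$ denotes the class of subspaces at finite Hausdorff distance from $A$. Stretch factors. A based quasi-isometry $f:(X(\Gamma),l)\to(X(\Lambda),l')$, with $l,l'$ standard geodesics, is a quasi-isometry $f:X(\Gamma)\to X(\Lambda)$ with $[f(l)]=[l']$. Identify $v(l),v(l')$ isometrically with $\mathbb{Z}$. For $C\ge0$, $\mathrm{str}(f,l,C):=r\in\mathbb{Q}_{>0}$ if $f|_{v(l)}$ is $C$-close (in sup distance) to a map $v(l)\to v(l')$ of the form $n\mapsto\pm\lfloor rn\rfloor+b$; if defined for some sufficiently large $C$ it is denoted $\mathrm{str}(f,l)$. A standard geodesic $l\subseteq X(\Gamma)$ is an $\mathcal{R}$-geodesic if for every RAAG $A(\Lambda)$, every standard geodesic $l'\subseteq X(\Lambda)$ and every pair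 of based quasi-isometries $f,g:(X(\Gamma),l)\to(X(\Lambda),l')$, $\mathrm{str}(f,l)$ and $\mathrm{str}(g,l)$ are well-defined and equal; otherwise $l$ is an $\mathcal{F}$-geodesic. Peripheral structures. A peripheral structure $\mathcal{P}_X$ on a metric space $X$ is a set whose elements are families $\{A_i\}_{i\in I}$ of subsets of $X$ pairwise at finite Hausdorff distance. A relative quasi-isometry $(f,f_* ):(X,\mathcal{P}_X)\to(Y,\mathcal{P}_Y)$ is a $(K,A)$-quasi-isometry $f$ (for some $K\ge1,A\ge0$) with a bijection $f_*:\mathcal{P}_X\to\mathcal{P}_Y$ such that if $f_*(\{A_i\}_{i\in I})=\{B_j\}_{j\in J}$, then for every $i$ there is $j$ with $d_{\mathrm{Haus}}(f(A_i),B_j)\le A$, and for every $j$ there is $i$ with $d_{\mathrm{Haus}}(f(A_i),B_j)\le A$. For a standard geodesic $l$, $\mathcal{S}_l$ is the set of standard geodesics parallel to $l$ (at finite Hausdorff distance from $l$). For $B\subseteq V\Gamma$, $\mathcal{P}_B=\{\mathcal{S}_l : l \text{ labelled by an element of } B\}$. A decoration on $\mathcal{P}_B$ is an $A(\Gamma)$-invariant map $\delta:\mathcal{P}_B\to\mathcal{O}$ to a set of ornaments. Given RAAGs $A(\Gamma),A(\Lambda)$, $B_\Gamma\subseteq V\Gamma$, $B_\Lambda\subseteq V\Lambda$, decorations $\delta_\Gamma,\delta_\Lambda$ of $\mathcal{P}_{B_\Gamma},\mathcal{P}_{B_\Lambda}$ with the same set of ornaments, and standard geodesics $l\subseteq X(\Gamma)$,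 $l'\subseteq X(\Lambda)$, a quasi-isometry $f:(X(\Gamma),\mathcal{P}_{B_\Gamma},\delta_\Gamma,l)\to(X(\Lambda),\mathcal{P}_{B_\Lambda},\delta_\Lambda,l')$ means a relative quasi-isometry $(f,f_* ):(X(\Gamma),\mathcal{P}_{B_\Gamma})\to(X(\Lambda),\mathcal{P}_{B_\Lambda})$ with $\delta_\Gamma=\delta_\Lambda\circ f_*$ and $[f(l)]=[l']$. A function to $\mathbb{Q}_{>0}$ is bi-bounded if its values lie in $[1/M,M]$ for some $M\ge1$. $A(\Gamma)$ is a dovetail RAAG if: whenever $f:(X(\Gamma),\mathcal{P}_{B_\Gamma},\delta_\Gamma,l)\to(X(\Lambda),\mathcal{P}_{B_\Lambda},\delta_\Lambda,l')$ is such a quasi-isometry (for any $\Lambda,B_\Gamma,B_\Lambda,\delta_\Gamma,\delta_\Lambda,l,l'$) and $\lambda:\mathcal{P}_{B_\Gamma}\to\mathbb{Q}_{>0}$ is bi-bounded and constant on $\delta_\Gamma^{-1}(o)$ for each ornament $o$, there exist a constant $C$ and a quasi-isometry $(g,g_* ):(X(\Gamma),\mathcal{P}_{B_\Gamma},\delta_\Gamma,l)\to(X(\Lambda),\mathcal{P}_{B_\Lambda},\delta_\Lambda,l')$ such that (1) $\mathrm{str}(g,l'',C)=\lambda(\mathcal{S}_{l''})$ for every $\mathcal{F}$-geodesic $l''$ labelled by an element of $B_\Gamma$; (2) $\mathrm{str}(g,l'',C)=\mathrm{str}(g,l'')$ for every $\mathcal{R}$-geodesic $l''$ labelled by an element of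 $B_\Gamma$. *)

(* Defs.v *)
From HB Require Import structures.
From Stdlib Require Import Relation_Operators.
From mathcomp Require Import all_boot all_order all_algebra.
From mathcomp Require Import generic_quotient.
From mathcomp Require Import boolp classical_sets functions reals ereal.
From mathcomp Require Import topology metric_structure.
From mathcomp Require Import lra.

Set Implicit Arguments.
Unset Strict Implicit.
Unset Printing Implicit Defensive.

Import Order.TTheory GRing.Theory Num.Theory.
Local Open Scope classical_set_scope.
Local Open Scope quotient_scope.
Local Open Scope ring_scope.

Record sgraph := SGraph {
  vertex :> finType;
  adj : rel vertex;
  adj_sym : symmetric adj;
  adj_irr : irreflexive adj }.

Section CompleteGraph.
Variable n : nat.

Let neq_sym : symmetric (fun i j : 'I_n => i != j).
Proof. by move=> i j; rewrite eq_sym. Qed.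

Let neq_irr : irreflexive (fun i j : 'I_n => i != j).
Proof. by move=> i; rewrite eqxx. Qed.

Definition complete_graph : sgraph := SGraph neq_sym neq_irr.
End CompleteGraph.

Definition clique (G : sgraph) (s : {set G}) : bool :=
  [forall v in s, forall w in s, (v != w) ==> adj v w].

Section RAAG.
Variable G : sgraph.

(* The letter (v, true) stands for v and (v, false) for v^-1. *)
Definition word : Type := seq (G * bool).

Inductive word_step : word -> word -> Prop :=
| step_cancel (a b : word) (v : G) (e : bool) :
    word_step (a ++ [:: (v, e); (v, ~~ e)] ++ b) (a ++ b)
| step_relator (a b : word) (v w : G) : adj v w ->
    word_step
      (a ++ [:: (v, true); (w, true); (v, false); (w, false)] ++ b) (a ++ b).

Definition word_eq (a b : word) : bool := `[< clos_refl_sym_trans _ word_step a b >].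

Lemma word_eq_refl : reflexive word_eq.
Proof. by move=> a; apply/asboolP; apply: rst_refl. Qed.

Lemma word_eq_sym : symmetric word_eq.
Proof.
by move=> a b; apply/asboolP/asboolP => h; apply: rst_sym.
Qed.

Lemma word_eq_trans : transitive word_eq.
Proof.
by move=> b a c /asboolP h1 /asboolP h2; apply/asboolP; apply: rst_trans h1 h2.
Qed.

Lemma word_eq_step (a b : word) : word_step a b -> word_eq a b.
Proof. by move=> h; apply/asboolP; apply: rst_step. Qed.

Canonical word_eq_equiv : equiv_rel word :=
  EquivRel word_eq word_eq_refl word_eq_sym word_eq_trans.

Definition raag : Type := {eq_quot word_eq}.

HB.instance Definition _ := Choice.on raag.
HB.instance Definition _ := Quotient.on raag.
HB.instance Definition _ := EqQuotient.on raag.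

Local Notation pi w := (\pi_(raag)%qT w).

Lemma raag_piE (a b : word) : pi a = pi b <-> word_eq a b.
Proof. by split=> [/eqquotP|h]; last apply/eqquotP. Qed.

Lemma word_eq_cat2l (c a b : word) : word_eq a b -> word_eq (c ++ a) (c ++ b).
Proof.
move=> /asboolP; elim=> {a b} [a b []|a|a b _ IH|a b d _ IH1 _ IH2].
- move=> a1 b1 v e; rewrite !(catA c); apply: word_eq_step.
  exact: step_cancel.
- move=> a1 b1 v w vw; rewrite !(catA c); apply: word_eq_step.
  exact: step_relator.
- exact: word_eq_refl.
- by rewrite word_eq_sym.
- exact: word_eq_trans IH1 IH2.
Qed.

Lemma word_eq_cat2r (c a b : word) : word_eq a b -> word_eq (a ++ c) (b ++ c).
Proof.
move=> /asboolP; elim=> {a b} [a b []|a|a b _ IH|a b d _ IH1 _ IH2].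
- move=> a1 b1 v e; rewrite -!catA; apply: word_eq_step.
  exact: (step_cancel a1 (b1 ++ c)).
- move=> a1 b1 v w vw; rewrite -!catA; apply: word_eq_step.
  exact: (step_relator a1 (b1 ++ c)).
- exact: word_eq_refl.
- by rewrite word_eq_sym.
- exact: word_eq_trans IH1 IH2.
Qed.

Lemma word_eq_cat (a b c d : word) :
  word_eq a b -> word_eq c d -> word_eq (a ++ c) (b ++ d).
Proof.
move=> ab cd; apply: word_eq_trans (word_eq_cat2r c ab) _.
exact: word_eq_cat2l.
Qed.

Definition word_inv (a : word) : word := rev [seq (x.1, ~~ x.2) | x <- a].

Lemma word_inv_cons x (a : word) :
  word_inv (x :: a) = word_inv a ++ [:: (x.1, ~~ x.2)].
Proof. by rewrite /word_inv /= rev_cons -cats1. Qed.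

Lemma word_invK : involutive word_inv.
Proof.
move=> a; rewrite /word_inv map_rev revK -map_comp -[RHS]map_id.
by apply: eq_map => -[v e] /=; rewrite negbK.
Qed.

Lemma word_mulV (a : word) : word_eq (a ++ word_inv a) [::].
Proof.
elim: a => [|[v e] a IH]; first exact: word_eq_refl.
rewrite word_inv_cons.
have h := word_eq_cat2l [:: (v, e)] (word_eq_cat2r [:: (v, ~~ e)] IH).
rewrite -(catA a) in h; apply: word_eq_trans h _.
exact/word_eq_step/(step_cancel [::] [::]).
Qed.

Lemma word_Vmul (a : word) : word_eq (word_inv a ++ a) [::].
Proof. by rewrite -{2}(word_invK a); exact: word_mulV. Qed.

Lemma word_eq_inv (a b : word) :
  word_eq a b -> word_eq (word_inv a) (word_inv b).
Proof.
move=> ab; have h := word_eq_cat2l (word_inv a) (word_mulV b).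
rewrite cats0 catA in h; rewrite word_eq_sym in h.
apply: word_eq_trans h _.
apply: (@word_eq_trans ([::] ++ word_inv b)); last exact: word_eq_refl.
apply: word_eq_cat2r; apply: word_eq_trans (word_Vmul a).
by apply: word_eq_cat2l; rewrite word_eq_sym.
Qed.

Definition raag_mul (x y : raag) : raag := pi (repr x ++ repr y).
Definition raag_one : raag := pi [::].
Definition raag_inv (x : raag) : raag := pi (word_inv (repr x)).

Lemma word_eq_repr (a : word) : word_eq (repr (pi a)) a.
Proof. by apply/raag_piE; rewrite reprK. Qed.

Lemma raag_mulE (a b : word) : raag_mul (pi a) (pi b) = pi (a ++ b).
Proof. by apply/raag_piE; apply: word_eq_cat; apply: word_eq_repr. Qed.

Lemma raag_invE (a : word) : raag_inv (pi a) = pi (word_inv a).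
Proof. by apply/raag_piE; apply: word_eq_inv; apply: word_eq_repr. Qed.

Lemma raag_mulA : associative raag_mul.
Proof.
move=> x y z; rewrite -(reprK x) -(reprK y) -(reprK z).
set a := repr x; set b := repr y; set c := repr z.
by rewrite (raag_mulE b c) (raag_mulE a b) (raag_mulE a) raag_mulE catA.
Qed.

Lemma raag_mul1 : left_id raag_one raag_mul.
Proof. by move=> x; rewrite -(reprK x) raag_mulE. Qed.

Lemma raag_mulr1 : right_id raag_one raag_mul.
Proof. by move=> x; rewrite -(reprK x) raag_mulE cats0. Qed.

Lemma raag_mulV : left_inverse raag_one raag_inv raag_mul.
Proof.
move=> x; rewrite -(reprK x) raag_invE raag_mulE.
by apply/raag_piE; apply: word_Vmul.
Qed.

Lemma raag_mulrV : right_inverse raag_one raag_inv raag_mul.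
Proof.
move=> x; rewrite -(reprK x) raag_invE raag_mulE.
by apply/raag_piE; apply: word_mulV.
Qed.

HB.instance Definition _ := isGroup.Build raag
  raag_mulA raag_mul1 raag_mulr1 raag_mulV raag_mulrV.

Definition gen (v : G) : raag := pi [:: (v, true)].

Lemma genV (v : G) : ((gen v)^-1)%g = pi [:: (v, false)].
Proof. exact: raag_invE. Qed.

Lemma gen_commute (v w : G) : adj v w -> commute (gen v) (gen w).
Proof.
move=> vw.
have h : (gen v * gen w * (gen v)^-1 * (gen w)^-1 = 1)%g.
  rewrite !genV; change (raag_mul (raag_mul (raag_mul (gen v) (gen w))
    (pi [:: (v, false)])) (pi [:: (w, false)]) = raag_one).
  rewrite (raag_mulE [:: (v, true)] [:: (w, true)]).
  rewrite (raag_mulE ([:: _] ++ [:: _]) [:: (v, false)]).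
  rewrite (raag_mulE (([:: _] ++ [:: _]) ++ [:: _]) [:: (w, false)]).
  apply/raag_piE; apply: word_eq_step.
  exact: (step_relator [::] [::]).
move/(congr1 (fun x => x * gen w * gen v)%g): h.
by rewrite mul1g !mulgVK.
Qed.

Lemma raag_ind (P : raag -> Prop) : P 1%g ->
  (forall g v, P g -> P (g * gen v)%g) ->
  (forall g v, P (g * gen v)%g -> P g) -> forall g, P g.
Proof.
move=> P1 PM PV g; rewrite -(reprK g).
elim/last_ind: (repr g) => [//|w [v e] IH].
case: e; rewrite -cats1.
  by rewrite -raag_mulE; apply: PM.
apply: (PV _ v).
rewrite (_ : (pi _ * gen v)%g = pi w) //.
transitivity (pi ((w ++ [:: (v, false)]) ++ [:: (v, true)])).
  exact: raag_mulE.
apply/raag_piE; rewrite -catA -[X in word_eq _ X]cats0.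
by apply: word_eq_cat2l; apply: word_eq_step; apply: (step_cancel [::] [::]).
Qed.

(* For a set of pairwise commuting generators the enumeration order is
   irrelevant. *)
Definition gen_prod (s : {set G}) : raag :=
  \big[*%g/1%g]_(v in s) gen v.

Lemma gen_prod0 : gen_prod finset.set0 = 1%g.
Proof. exact: big_set0. Qed.

Lemma gen_prod1 v : gen_prod [set v]%SET = gen v.
Proof. exact: big_set1. Qed.

Lemma clique_commute (s : {set G}) : clique s ->
  {in s &, forall v w, commute (gen v) (gen w)}.
Proof.
move=> /forall_inP cs v w vs ws; have [->//|vw] := eqVneq v w.
by apply: gen_commute; move/forall_inP: (cs v vs) => /(_ w ws)/implyP; apply.
Qed.

Lemma gen_prodU (s a b : {set G}) : clique s -> a \subset s -> b \subset s ->
  (forall v, v \in a -> v \notin b) ->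
  gen_prod (a :|: b)%SET = (gen_prod a * gen_prod b)%g.
Proof.
move=> cs /fintype.subsetP sa /fintype.subsetP sb dab; rewrite /gen_prod.
elim: (index_enum G) => [|v r IH]; first by rewrite !big_nil mulg1.
rewrite !big_cons inE IH; case va: (v \in a); case vb: (v \in b) => //=.
- by move: (dab v va); rewrite vb.
- by rewrite mulgA.
rewrite !mulgA; congr (_ * _)%g.
elim: r {IH} => [|w r IH]; first by rewrite !big_nil mulg1 mul1g.
rewrite !big_cons; case wa: (w \in a) => //.
rewrite mulgA (clique_commute cs (sb _ vb) (sa _ wa)) -mulgA IH.
by rewrite mulgA.
Qed.

End RAAG.

(* A point of X(Gamma) lies in the interior of exactly one cube.  The edges of
   that cube are oriented by their labels; we record its minimal vertex g and
   the coordinates t : V -> [0, 1[ of the point, whose support is the clique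
   labelling the cube. *)
Section Salvetti.
Variables (R : realType) (G : sgraph).

Definition is_point (p : raag G * {ffun G -> R}) : bool :=
  [forall v, 0 <= p.2 v < 1] && clique [set v | p.2 v != 0]%SET.

Record salvetti : Type := Point { point_val :> raag G * {ffun G -> R}; _ : is_point point_val }.

HB.instance Definition _ := [isSub for point_val].
HB.instance Definition _ := [Choice of salvetti by <:].

Definition base (x : salvetti) : raag G := (val x).1.
Definition coord (x : salvetti) : {ffun G -> R} := (val x).2.

Definition ones (s : {ffun G -> R}) : {set G} := [set v | s v == 1]%SET.

(* x is the image of s in [0, 1]^V under the characteristic map of the closed
   cube with minimal vertex g (s is supported on the clique of the cube). *)
Definition cube_pt (g : raag G) (s : {ffun G -> R}) (x : salvetti) : Prop :=
  base x = (g * gen_prod (ones s))%g /\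
  forall v, coord x v = if s v == 1 then 0 else s v.

Definition in_cube (sigma : {set G}) (s : {ffun G -> R}) : Prop :=
  forall v, 0 <= s v <= 1 /\ (v \notin sigma -> s v = 0).

Definition eucl_dist (s t : {ffun G -> R}) : R :=
  Num.sqrt (\sum_v (s v - t v) ^+ 2).

(* x and y lie in a common closed cube, where their distance is r. *)
Definition cube_step (x y : salvetti) (r : R) : Prop :=
  exists g sigma s t, [/\ clique sigma, in_cube sigma s /\ in_cube sigma t,
    cube_pt g s x, cube_pt g t y & r = eucl_dist s t].

Inductive string : salvetti -> salvetti -> R -> Prop :=
| string_nil x : string x x 0
| string_cons x y z r L :
    cube_step x y r -> string y z L -> string x z (r + L).

(* The intrinsic metric of the piecewise Euclidean cube complex, which is
   CAT(0): the infimum of the lengths of strings from x to y. *)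
Definition sdist (x y : salvetti) : R := inf [set L | string x y L].

Implicit Types (d r L M e : R) (x y z : salvetti) (s t : {ffun G -> R}) (v : G) (g : raag G).

Lemma salvetti_eq x y : base x = base y -> coord x = coord y -> x = y.
Proof.
case: x y => [[g s] ?] [[h t] ?]; rewrite /base /coord /= => gh st.
by apply/val_inj; rewrite /= gh st.
Qed.

Lemma coordP x v : 0 <= coord x v < 1.
Proof. by have /andP[/forallP h _] := valP x; exact: h. Qed.

Lemma clique_supp x : clique [set v | coord x v != 0]%SET.
Proof. by have /andP[] := valP x. Qed.

Lemma eucl_dist_ge0 s t : 0 <= eucl_dist s t.
Proof. exact: sqrtr_ge0. Qed.

Lemma eucl_dist_sym s t : eucl_dist s t = eucl_dist t s.
Proof.
by congr (Num.sqrt _); apply: eq_bigr => v _; rewrite -opprB sqrrN.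
Qed.

Lemma le_eucl_dist s t v : `|s v - t v| <= eucl_dist s t.
Proof.
rewrite -sqrtr_sqr ler_wsqrtr // (bigD1 v) //= lerDl.
by apply: sumr_ge0 => w _; exact: sqr_ge0.
Qed.

Lemma cube_step_sym x y r : cube_step x y r -> cube_step y x r.
Proof.
move=> [g [sigma [s [t [cs [hs ht] hx hy ->]]]]].
by exists g, sigma, t, s; split => //; rewrite eucl_dist_sym.
Qed.

Lemma cube_step_ge0 x y r : cube_step x y r -> 0 <= r.
Proof. by move=> [? [? [? [? [_ _ _ _ ->]]]]]; exact: eucl_dist_ge0. Qed.

Lemma string_ge0 x y L : string x y L -> 0 <= L.
Proof.
elim=> // {}x {}y z r {}L /cube_step_ge0 r0 _ L0; exact: addr_ge0.
Qed.

Lemma string_cat x y z L M : string x y L -> string y z M -> string x z (L + M).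
Proof.
move=> h; elim: h M => [?|? ? ? r L' st _ IH] M hM; first by rewrite add0r.
by rewrite -addrA; apply: string_cons st (IH _ hM).
Qed.

Lemma string1 x y r : cube_step x y r -> string x y r.
Proof. by move=> h; rewrite -[r]addr0; apply: string_cons h (string_nil _). Qed.

Lemma string_sym x y L : string x y L -> string y x L.
Proof.
elim=> [?|{}x {}y z r {}L st _ IH]; first exact: string_nil.
by rewrite addrC; apply: string_cat IH (string1 (cube_step_sym st)).
Qed.

Lemma is_point_vertex (g : raag G) : is_point (g, [ffun=> 0]).
Proof.
apply/andP; split; first by apply/forallP => v; rewrite ffunE lexx ltr01.
by apply/forall_inP => v; rewrite !inE ffunE eqxx.
Qed.

Definition vertex_pt (g : raag G) : salvetti := Point (is_point_vertex g).

Lemma cube_pt_self x : cube_pt (base x) (coord x) x.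
Proof.
have n1 v : (coord x v == 1) = false.
  by apply/negbTE; have /andP[_ /lt_eqF ->] := coordP x v.
split=> [|v]; last by rewrite n1.
rewrite (_ : ones _ = finset.set0) ?gen_prod0 ?mulg1 //.
by apply/setP => v; rewrite !inE n1.
Qed.

Lemma string_vertex x : exists L, string x (vertex_pt (base x)) L.
Proof.
exists (eucl_dist (coord x) [ffun=> 0]); apply: string1.
exists (base x), [set v | coord x v != 0]%SET, (coord x), [ffun=> 0].
split=> //; first exact: clique_supp.
- split=> v; last by rewrite ffunE lexx ler01.
  have /andP[-> /ltW ->] := coordP x v; split=> //.
  by rewrite inE negbK => /eqP.
- exact: cube_pt_self.
- exact: (cube_pt_self (vertex_pt (base x))).
Qed.

Lemma string_edge g v : exists L, string (vertex_pt g) (vertex_pt (g * gen v)%g) L.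
Proof.
pose t : {ffun G -> R} := [ffun w => (w == v)%:R].
exists (eucl_dist [ffun=> 0] t); apply: string1.
exists g, [set v]%SET, [ffun=> 0], t; split=> //.
- apply/forall_inP => u; rewrite inE => /eqP ->.
  by apply/forall_inP => w; rewrite inE => /eqP ->; rewrite eqxx.
- split=> w; rewrite !ffunE ?lexx ?ler01 // inE.
  by case: eqP => _; rewrite ?lexx ?ler01.
- exact: (cube_pt_self (vertex_pt g)).
- split=> [|w].
    rewrite (_ : ones t = [set v]%SET) ?gen_prod1 //.
    apply/setP => w; rewrite !inE ffunE.
    by case: (w == v); rewrite ?eqxx // eq_sym oner_eq0.
  rewrite !ffunE; case: (w == v); rewrite ?eqxx //.
  by rewrite eq_sym oner_eq0.
Qed.

Lemma string_ex x y : exists L, string x y L.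
Proof.
suff h g : exists L, string (vertex_pt 1%g) (vertex_pt g) L.
  have [L1 h1] := string_vertex x; have [L2 h2] := string_vertex y.
  have [L3 h3] := h (base x); have [L4 h4] := h (base y).
  eexists; apply: string_cat h1 (string_cat (string_sym h3) _).
  exact: string_cat h4 (string_sym h2).
elim/raag_ind: g => [|g v [L h]|g v [L h]].
- by exists 0; exact: string_nil.
- by have [M hM] := string_edge g v; eexists; apply: string_cat h hM.
- have [M hM] := string_edge g v; eexists.
  exact: string_cat h (string_sym hM).
Qed.

Lemma has_inf_string x y : has_inf [set L | string x y L].
Proof.
by split; [exact: string_ex | exists 0 => L; exact: string_ge0].
Qed.

Lemma sdist_le x y L : string x y L -> sdist x y <= L.
Proof. by move=> h; apply: ge_inf => //; exact: (has_inf_string x y).2. Qed.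

Lemma sdist_ge0 x y : 0 <= sdist x y.
Proof.
by apply: lb_le_inf; [exact: string_ex | move=> L; exact: string_ge0].
Qed.

Lemma sdist_string x y e : 0 < e -> exists2 L, string x y L & L < sdist x y + e.
Proof. by move=> e0; exact: (inf_adherent e0 (has_inf_string x y)). Qed.

Lemma sdistxx x : sdist x x = 0.
Proof.
by apply/eqP; rewrite eq_le sdist_ge0 andbT; apply/sdist_le/string_nil.
Qed.

Lemma sdist_sym x y : sdist x y = sdist y x.
Proof.
by congr inf; apply/seteqP; split=> L; exact: string_sym.
Qed.

Lemma sdist_triangle y x z : sdist x z <= sdist x y + sdist y z.
Proof.
apply/ler_addgt0Pr => e e0; have e2 : 0 < e / 2 by rewrite divr_gt0.
have [L hL Le] := sdist_string x y e2; have [M hM Me] := sdist_string y z e2.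
apply: le_trans (sdist_le (string_cat hL hM)) _; lra.
Qed.

Section Positivity.
Variables (t : {ffun G -> R}) (eps : R).
Hypothesis t01 : forall v, 0 <= t v < 1.
Hypothesis eps4 : eps <= (4^-1 : R).
Hypothesis eps_t : forall v, t v != 0 -> eps <= t v <= 1 - eps.

Let near (d : R) (x : salvetti) : Prop := forall v,
  `|coord x v - t v| <= d \/ (t v = 0 /\ 1 - coord x v <= d).

Let hi (x : salvetti) : {set G} := [set v | (t v == 0) && (2^-1 < coord x v)]%SET.

Let hi_cube (s : {ffun G -> R}) : {set G} :=
  [set v | (t v == 0) && (2^-1 < s v)]%SET.

Let near_cube (d : R) g sigma s x : 0 <= d -> d < eps -> in_cube sigma s ->
  cube_pt g s x -> near d x -> forall v,
  if t v == 0 then s v <= d \/ 1 - s v <= d else `|s v - t v| <= d /\ s v < 1.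
Proof.
move=> d0 de hs [_ hx] nx v; have := nx v; rewrite hx.
have [s01 _] := hs v; have /andP[t0 t1] := t01 v.
case: (eqVneq (t v) 0) => [tv|tv].
  rewrite tv subr0; case: (eqVneq (s v) 1) => [-> _|s1]; first by right; lra.
  by move=> [|[_]]; [rewrite ger0_norm; [left|lra]|right].
have := eps_t tv; case: (eqVneq (s v) 1) => [s1|s1] ept.
  by rewrite sub0r normrN => -[|[/eqP]]; [rewrite ger0_norm //; lra|rewrite (negbTE tv)].
move=> [h|[/eqP]]; last by rewrite (negbTE tv).
by split=> //; move: h; rewrite ler_norml; lra.
Qed.

Let base_hi d g sigma s x : 0 <= d -> d < eps -> clique sigma ->
  in_cube sigma s -> cube_pt g s x -> near d x ->
  (base x * gen_prod (hi x) = g * gen_prod (hi_cube s))%g.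
Proof.
move=> d0 de cs hs hx nx; have nc := near_cube d0 de hs hx nx.
case: hx => bx cx; rewrite bx -mulgA; congr (_ * _)%g.
rewrite -(gen_prodU cs).
- congr gen_prod; apply/setP => v; rewrite !inE cx; have := nc v.
  case: (eqVneq (t v) 0) => tv; case: (eqVneq (s v) 1) => s1 //=.
    by move=> _; rewrite s1; apply/esym; lra.
  by rewrite s1 ltxx => -[].
- apply/fintype.subsetP => v; rewrite inE => /eqP s1; apply/negPn/negP => vs.
  by have [_ /(_ vs)/eqP] := hs v; rewrite s1 oner_eq0.
- apply/fintype.subsetP => v; rewrite inE cx => /andP[_ h].
  apply/negPn/negP => vs; have [_ /(_ vs) s0] := hs v.
  by move: h; rewrite s0 eq_sym oner_eq0; lra.
- move=> v; rewrite !inE cx => ->; apply/negP => /andP[_]; lra.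
Qed.

Let near_step d x y r : 0 <= d -> d + r < eps -> cube_step x y r -> near d x ->
  near (d + r) y /\
  (base x * gen_prod (hi x) = base y * gen_prod (hi y))%g.
Proof.
move=> d0 dre st; have r0 := cube_step_ge0 st.
case: st => g [sigma [s [s' [cs [hs hs'] hx hy rE]]]] nx.
have de : d < eps by lra.
have nc := near_cube d0 de hs hx nx.
have st v : `|s v - s' v| <= r by rewrite rE; exact: le_eucl_dist.
have ny : near (d + r) y.
  move=> v; case: (hy) => _ ->; have := nc v; have := st v.
  have [s01 _] := hs v; have [s01' _] := hs' v.
  have /andP[t0 t1] := t01 v.
  case: (eqVneq (t v) 0) => [tv|tv]; rewrite ler_norml => st'.
    rewrite tv subr0; case: (eqVneq (s' v) 1) => [_|s1] h.
      by left; rewrite normr0; lra.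
    by rewrite ger0_norm; [case: h => h; [left|right; split=> //]; lra|lra].
  have ept := eps_t tv.
  by rewrite ler_norml => -[h1 h2]; left; case: eqP => s1; rewrite ler_norml; lra.
split=> //.
have dr0 : 0 <= d + r by lra.
rewrite (base_hi d0 de cs hs hx nx) (base_hi dr0 dre cs hs' hy ny).
congr (_ * gen_prod _)%g; apply/setP => v; rewrite !inE.
have e4 : eps <= 4^-1 by exact: eps4.
have := nc v; case: eqP => //= _ h; have := st v; rewrite ler_norml.
by move=> st'; apply/idP/idP => ?; case: h => ?; lra.
Qed.

Lemma near_string x y L d : 0 <= d -> string x y L -> d + L < eps -> near d x ->
  near (d + L) y /\
  (base x * gen_prod (hi x) = base y * gen_prod (hi y))%g.
Proof.
move=> + h; elim: h d => {x y L} [x d|x y z r L st hL IH d] d0 de nx.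
  by rewrite addr0.
have r0 := cube_step_ge0 st; have L0 := string_ge0 hL.
have [|ny ->] := near_step d0 _ st nx; first by lra.
rewrite addrA; apply: IH => //; lra.
Qed.

Lemma near_eq x y : coord x = t -> 0 < eps ->
  (forall e, 0 < e -> exists2 L, string x y L & L < e) -> x = y.
Proof.
move=> xt e0 small.
have nx : near 0 x by move=> v; left; rewrite xt subrr normr0.
have ny e : 0 < e -> near e y /\
    (base x * gen_prod (hi x) = base y * gen_prod (hi y))%g.
  move=> ep; have m0 : 0 < Num.min e eps by rewrite lt_min ep.
  have [L hL] := small _ m0; rewrite lt_min => /andP[Le Leps].
  have [|n ->] := near_string (lexx 0) hL _ nx; first by rewrite add0r.
  split=> // v; rewrite add0r in n.
  by case: (n v) => [|[? ?]]; [left|right; split=> //]; lra.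
have ct : coord x = coord y.
  rewrite xt; apply/ffunP => v; apply/eqP/negPn/negP => ne.
  have c1 := coordP y v.
  have dp : 0 < `|coord y v - t v| by rewrite normr_gt0 subr_eq0 eq_sym.
  pose e : R := Num.min (`|coord y v - t v|) (1 - coord y v) / 2.
  have m0 : 0 < Num.min (`|coord y v - t v|) (1 - coord y v).
    by rewrite lt_min dp; lra.
  have mle : Num.min (`|coord y v - t v|) (1 - coord y v) <= `|coord y v - t v|.
    by rewrite ge_min lexx.
  have mle' : Num.min (`|coord y v - t v|) (1 - coord y v) <= 1 - coord y v.
    by rewrite ge_min lexx orbT.
  have ep : 0 < e by rewrite /e; lra.
  have [n _] := ny e ep; case: (n v) => [|[_]]; rewrite /e; lra.
apply: salvetti_eq => //.
have hi0 z : coord z = t -> hi z = finset.set0.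
  move=> zt; apply/setP => v; rewrite !inE zt.
  by case: eqP => //= ->; lra.
have [_] := ny 1 ltr01; rewrite !hi0 ?gen_prod0 ?mulg1 //.
by rewrite -ct.
Qed.

End Positivity.

Lemma sdist_positivity x y : sdist x y = 0 -> x = y.
Proof.
move=> d0.
pose F v : R := if coord x v == 0 then 4^-1
  else Num.min (coord x v) (1 - coord x v).
pose eps := \big[Num.min/4^-1]_v F v.
have epsF v : eps <= F v by exact: bigmin_le_cond.
apply: (@near_eq (coord x) eps) => //.
- exact: coordP.
- exact: bigmin_le_id.
- move=> v /negbTE v0; have := epsF v; rewrite /F v0 le_min; lra.
- apply: lt_bigmin; first by rewrite invr_gt0.
  move=> v _; rewrite /F; have c := coordP x v.
  case: eqP => [_|/eqP v0]; first by rewrite invr_gt0.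
  by rewrite lt_min lt_def v0; lra.
- move=> e e0; have [L hL] := sdist_string x y e0.
  by rewrite d0 add0r; exists L.
Qed.

HB.instance Definition _ := @isMetric.Build R salvetti sdist
  sdistxx sdist_positivity sdist_sym sdist_triangle.

End Salvetti.

Section CoarseGeometry.
Variable R : realType.

Definition nbhd (X : metricType R) (e : R) (A : set X) : set X :=
  [set x | exists2 a, A a & mdist x a <= e].

Definition dHaus (X : metricType R) (A B : set X) : \bar R :=
  ereal_inf [set e%:E | e in [set e : R |
    [/\ 0 <= e, A `<=` nbhd e B & B `<=` nbhd e A]]].

Definition coarse_class (X : metricType R) (A : set X) : set (set X) :=
  [set B | (dHaus A B < +oo)%E].

Definition is_quasi_isometry (X Y : metricType R) (K A : R) (f : X -> Y) : Prop :=
  [/\ 1 <= K, 0 <= A,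
    forall x y, K^-1 * mdist x y - A <= mdist (f x) (f y) <= K * mdist x y + A &
    forall y, exists x, mdist (f x) y <= A].

Definition quasi_isometry (X Y : metricType R) (f : X -> Y) : Prop :=
  exists K A, is_quasi_isometry K A f.

(* P and Q are sets of families of subsets, i.e. peripheral structures;
   fs matters only on P. *)
Definition relative_quasi_isometry (X Y : metricType R)
    (P : set (set (set X))) (Q : set (set (set Y)))
    (f : X -> Y) (fs : set (set X) -> set (set Y)) : Prop :=
  set_bij P Q fs /\
  exists K A, is_quasi_isometry K A f /\
    forall F, P F ->
      (forall a, F a -> exists2 b, fs F b & (dHaus (f @` a) b <= A%:E)%E) /\
      (forall b, fs F b -> exists2 a, F a & (dHaus (f @` a) b <= A%:E)%E).

(* An isometric identification of A with the integers. *)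
Definition isom_int (X : metricType R) (A : set X) (phi : int -> X) : Prop :=
  range phi = A /\ forall m n, mdist (phi m) (phi n) = `|m - n|%:~R.

End CoarseGeometry.

Section StandardGeodesics.
Variables (R : realType) (G : sgraph).
Local Notation X := (salvetti R G).

(* The line in the 1-skeleton with vertex set the coset g<w>. *)
Definition std_line (g : raag G) (w : G) : set X :=
  [set x | (exists n : nat, base x = (g * gen w ^+ n)%g \/
                            base x = (g * gen w ^- n)%g) /\
           forall v, v != w -> coord x v = 0].

Definition labelled (w : G) (l : set X) : Prop := exists g, l = std_line g w.

Definition std_geodesic (l : set X) : Prop := exists w, labelled w l.

Definition line_vertices (l : set X) : set X :=
  l `&` [set x | forall v, coord x v = 0].

Definition parallel_class (l : set X) : set (set X) :=
  [set m | std_geodesic m /\ (dHaus l m < +oo)%E].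

Definition peripheral (B : {set G}) : set (set (set X)) :=
  [set F | exists w l, [/\ w \in B, labelled w l & F = parallel_class l]].

Lemma is_point_translate (h : raag G) (x : X) :
  is_point ((h * base x)%g, coord x).
Proof. exact: (valP x). Qed.

Definition translate (h : raag G) (x : X) : X := Point (is_point_translate h x).

Definition decoration (B : {set G}) (O : Type) (delta : set (set X) -> O) : Prop :=
  forall h F, peripheral B F ->
    delta [set translate h @` l | l in F] = delta F.

End StandardGeodesics.

Arguments peripheral R {G} B.

Section Stretch.
Variables (R : realType) (G H : sgraph).
Local Notation X := (salvetti R G).
Local Notation Y := (salvetti R H).
Implicit Types (f : X -> Y) (l : set X) (m : set Y).

(* str(f, l, C) = r, computed with target line m.  The identifications of the
   vertex sets with the integers are existential; another choice changes C by
   a bounded amount and leaves r unchanged. *)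
Definition has_str_at f l m (C : R) (r : rat) : Prop :=
  [/\ 0 <= C, 0 < r &
    exists (phi : int -> X) (psi : int -> Y) (s : bool) (b : int),
      [/\ isom_int (line_vertices l) phi, isom_int (line_vertices m) psi &
        forall n : int, mdist (f (phi n))
          (psi ((-1) ^+ s * Num.floor (r * n%:~R) + b)) <= C]].

Definition has_str f l m (r : rat) : Prop := exists C, has_str_at f l m C r.

Definition based_quasi_isometry f l m : Prop :=
  quasi_isometry f /\ coarse_class (f @` l) = coarse_class m.

Definition decorated_quasi_isometry (BG : {set G}) (BH : {set H}) (O : Type)
    (dG : set (set X) -> O) (dH : set (set Y) -> O) l m
    f (fs : set (set X) -> set (set Y)) : Prop :=
  [/\ relative_quasi_isometry (peripheral R BG) (peripheral R BH) f fs,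
    forall F, peripheral R BG F -> dG F = dH (fs F) &
    coarse_class (f @` l) = coarse_class m].

End Stretch.

Definition R_geodesic (R : realType) (G : sgraph) (l : set (salvetti R G)) : Prop :=
  std_geodesic l /\
  forall (H : sgraph) (l' : set (salvetti R H)) (f g : salvetti R G -> salvetti R H),
    std_geodesic l' ->
    based_quasi_isometry f l l' -> based_quasi_isometry g l l' ->
    exists r, has_str f l l' r /\ has_str g l l' r.

Definition F_geodesic (R : realType) (G : sgraph) (l : set (salvetti R G)) : Prop :=
  std_geodesic l /\ ~ R_geodesic l.

Definition bi_bounded (T : Type) (P : set T) (lambda : T -> rat) : Prop :=
  exists2 M : rat, 1 <= M & forall x, P x -> M^-1 <= lambda x <= M.

Definition dovetail (R : realType) (G : sgraph) : Prop :=
  forall (H : sgraph) (BG : {set G}) (BH : {set H}) (O : Type)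
    (dG : set (set (salvetti R G)) -> O) (dH : set (set (salvetti R H)) -> O)
    (l : set (salvetti R G)) (l' : set (salvetti R H))
    (f : salvetti R G -> salvetti R H)
    (fs : set (set (salvetti R G)) -> set (set (salvetti R H)))
    (lambda : set (set (salvetti R G)) -> rat),
  decoration BG dG -> decoration BH dH ->
  std_geodesic l -> std_geodesic l' ->
  decorated_quasi_isometry BG BH dG dH l l' f fs ->
  (forall F, peripheral R BG F -> 0 < lambda F) ->
  bi_bounded (peripheral R BG) lambda ->
  (forall F F', peripheral R BG F -> peripheral R BG F' -> dG F = dG F' ->
    lambda F = lambda F') ->
  exists (C : R) (g : salvetti R G -> salvetti R H)
    (gs : set (set (salvetti R G)) -> set (set (salvetti R H))),
  [/\ decorated_quasi_isometry BG BH dG dH l l' g gs,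
    forall w k, w \in BG -> labelled w k -> F_geodesic k ->
      exists k', [/\ std_geodesic k', coarse_class (g @` k) = coarse_class k' &
        has_str_at g k k' C (lambda (parallel_class k))] &
    forall w k, w \in BG -> labelled w k -> R_geodesic k ->
      exists k', [/\ std_geodesic k', coarse_class (g @` k) = coarse_class k' &
        exists r, has_str_at g k k' C r /\ has_str g k k' r]].

Definition free_abelian_of_rank (n : nat) (A : groupType) : Prop :=
  exists2 phi : A -> 'rV[int]_n, bijective phi & {morph phi : x y / (x * y)%g >-> x + y}.

(* Main.v *)
From Pilot Require Import Defs.
From mathcomp Require Import all_boot all_order all_algebra.
From mathcomp Require Import generic_quotient.
From mathcomp Require Import boolp classical_sets functions reals ereal.
From mathcomp Require Import topology metric_structure.
From mathcomp Require Import zify lra.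
Import Pilot.Defs.

(** A free abelian right-angled Artin group A(G) has a complete graph G, since
    two non-adjacent generators never commute.  For complete G an element is
    determined by its exponents, and adding the coordinates inside a cube turns
    X(G) into R^G: the map [pos] is a bijection, each of its coordinates is
    1-Lipschitz, and the distance of two points is at most the l^1 distance of
    their images up to an additive constant.  In these coordinates the standard
    geodesics are lines parallel to the axes (with integral other coordinates),
    so that two of them are parallel exactly when their labels agree, and a
    peripheral structure P_B is just the set B of labels.

    Everything then rests on the maps [stretch], which permute the coordinates
    and multiply each by its own positive factor.  They are quasi-isometries,
    they carry the lines labelled w to within bounded distance of the lines
    labelled by the image of w, and they stretch these lines by the factor
    chosen for w, with one error bound for all lines.

    Consequences.  Multiplying all coordinates by 1, or by 2, gives two
    quasi-isometries of X(G) that both preserve the class of a given line but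
    have different stretch factors on it.  As a stretch factor is unique
    ([str_unique]), no line is an R-geodesic.  For the dovetail property, let
    f : X(G) -> X(H) be the given quasi-isometry.  A growth argument
    ([qi_complete]) shows that H is complete too, with as many vertices as G.
    The bijection f_* of peripheral structures is a bijection of labels
    B_G -> B_H.  As f takes l to l', it extends to the label of l, and then to a
    bijection of all vertices.  The required map is the stretch along this
    bijection with the factors lambda.

    The growth argument compares families of points indexed by N^j
    ([spread]): such a family grows at most linearly in its parameters, and its
    points separate when their parameters do.  Quasi-isometries transport these
    families, X(G) has one with j = #|G| when G is complete, and by counting
    lattice points it has none with larger j.  If H has two non-adjacent
    vertices v and w, then A(H) maps onto the lamplighter group Z wr Z, with v
    moving the lamplighter and w adding 1 to the lamp in front of it; the values
    of j lamps are 1-Lipschitz functions and can be set independently, so X(H)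
    has such families for all j. *)

Set Implicit Arguments.
Unset Strict Implicit.
Unset Printing Implicit Defensive.

Import Order.TTheory GRing.Theory Num.Theory.
Local Open Scope classical_set_scope.
Local Open Scope ring_scope.

(** * Actions of a right-angled Artin group and powers of its elements *)

Section RaagAction.
Variables (G : sgraph) (S : Type) (fwd bwd : G -> S -> S).
Hypothesis fwdK : forall v, cancel (fwd v) (bwd v).
Hypothesis bwdK : forall v, cancel (bwd v) (fwd v).
Hypothesis fwdC :
  forall v w, adj v w -> forall s, fwd v (fwd w s) = fwd w (fwd v s).

Definition letter_act (s : S) (x : G * bool) : S :=
  if x.2 then fwd x.1 s else bwd x.1 s.

Definition raag_act (s : S) (g : raag G) : S := foldl letter_act s (repr g).

(** The defining relations hold among the bijections [fwd v], so the action of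
    a word depends only on the element that it represents.  Applied to
    [repr g], this is the universal property by which all functions on the
    group below are defined. *)
Lemma word_eq_act (a b : word G) (s : S) : word_eq a b ->
  foldl letter_act s a = foldl letter_act s b.
Proof.
move=> /asboolP ab; elim: ab s => {a b}.
- move=> _ _ [] a b.
    move=> v e s; rewrite !foldl_cat /=; congr foldl.
    by rewrite /letter_act /=; case: e => /=; rewrite ?fwdK ?bwdK.
  move=> v w vw s; rewrite !foldl_cat /=; congr foldl.
  by rewrite /letter_act /= -fwdC // fwdK fwdK.
- by [].
- by move=> a b _ IH s; rewrite IH.
- by move=> a b c _ IH1 _ IH2 s; rewrite IH1 IH2.
Qed.

Lemma raag_act_pi (s : S) (a : word G) :
  raag_act s (\pi_(raag G)%qT a) = foldl letter_act s a.
Proof. exact/word_eq_act/word_eq_repr. Qed.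

Lemma raag_act1 (s : S) : raag_act s 1%g = s.
Proof. exact: (raag_act_pi s [::]). Qed.

Lemma raag_actM (s : S) (g h : raag G) :
  raag_act s (g * h)%g = raag_act (raag_act s g) h.
Proof.
rewrite -[g]reprK -[h]reprK.
transitivity (raag_act s (\pi_(raag G)%qT (repr g ++ repr h))).
  by congr raag_act; exact: raag_mulE.
by rewrite !raag_act_pi foldl_cat.
Qed.

Lemma raag_act_gen (s : S) v : raag_act s (gen v) = fwd v s.
Proof. exact: (raag_act_pi s [:: (v, true)]). Qed.

End RaagAction.

Section IntegerPowers.
Variable A : groupType.
Implicit Types (x y : A) (m n : int).

Definition zpow x n : A :=
  match n with Posz k => (x ^+ k)%g | Negz k => (x ^- k.+1)%g end.

Lemma zpow_succ x n : zpow x (n + 1) = (zpow x n * x)%g.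
Proof.
case: n => n.
  have -> : Posz n + 1 = Posz n.+1 by lia.
  exact: expgSr.
case: n => [|n]; first by rewrite /= expg1 mulVg.
have -> : Negz n.+1 + 1 = Negz n by lia.
by rewrite /= [X in _ = (X^-1 * _)%g]expgS invgM mulgVK.
Qed.

Lemma zpow_pred x n : zpow x (n - 1) = (zpow x n * x^-1)%g.
Proof. by rewrite -[in RHS](subrK 1 n) zpow_succ mulgK. Qed.

Lemma zpow_ind (P : int -> Prop) : P 0 -> (forall n, P n -> P (n + 1)) ->
  (forall n, P n -> P (n - 1)) -> forall n, P n.
Proof.
move=> P0 PS PP; elim/int_rect => [//|n IH|n IH].
  by rewrite -addn1 PoszD; apply: PS.
by rewrite -addn1 PoszD opprD; apply: PP.
Qed.

Lemma zpowD x m n : zpow x (m + n) = (zpow x m * zpow x n)%g.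
Proof.
elim/zpow_ind: n => [|n IH|n IH].
- by rewrite addr0 mulg1.
- by rewrite addrA !zpow_succ IH mulgA.
- by rewrite addrA !zpow_pred IH mulgA.
Qed.

Lemma commute_zpow x y n : commute x y -> commute x (zpow y n).
Proof.
move=> xy; elim/zpow_ind: n => [|n IH|n IH].
- exact: commute1.
- by rewrite zpow_succ; exact: commuteM.
- by rewrite zpow_pred; apply: commuteM => //; exact: commuteV.
Qed.

End IntegerPowers.

(** * Exponent sums *)

Section Exponent.
Variable G : sgraph.
Implicit Types (g h : raag G) (v w : G).

Definition exponent w g : int :=
  raag_act (fun v z => z + (v == w)%:Z) (fun v z => z - (v == w)%:Z) 0 g.

Let addK v w : cancel (fun z : int => z + (v == w)%:Z) (fun z => z - (v == w)%:Z).
Proof. exact: addrK. Qed.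
Let subK v w : cancel (fun z : int => z - (v == w)%:Z) (fun z => z + (v == w)%:Z).
Proof. exact: subrK. Qed.
Let addC w (u v : G) : adj u v -> forall z : int,
  z + (v == w)%:Z + (u == w)%:Z = z + (u == w)%:Z + (v == w)%:Z.
Proof. by move=> _ z; rewrite addrAC. Qed.

Lemma exponent1 w : exponent w 1%g = 0.
Proof. exact: (raag_act1 (addK^~ w) (subK^~ w) (@addC w)). Qed.

Lemma exponent_gen w g v : exponent w (g * gen v)%g = exponent w g + (v == w)%:Z.
Proof.
by rewrite /exponent (raag_actM (addK^~ w) (subK^~ w) (@addC w))
  (raag_act_gen (addK^~ w) (subK^~ w) (@addC w)).
Qed.

Lemma exponentM w g h : exponent w (g * h)%g = exponent w g + exponent w h.
Proof.
elim/raag_ind: h => [|h v IH|h v IH].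
- by rewrite mulg1 exponent1 addr0.
- by rewrite mulgA !exponent_gen IH addrA.
- by move: IH; rewrite mulgA !exponent_gen addrA => /addIr.
Qed.

Lemma exponentV w g : exponent w (g^-1)%g = - exponent w g.
Proof. by apply/eqP; rewrite -addr_eq0 -exponentM mulVg exponent1. Qed.

Lemma exponent_of_gen w v : exponent w (gen v) = (v == w)%:Z.
Proof. by rewrite -[gen v]mul1g exponent_gen exponent1 add0r. Qed.

Lemma exponent_zpow w v n :
  exponent w (zpow (gen v) n) = if v == w then n else 0.
Proof.
elim/zpow_ind: n => [|n IH|n IH].
- by rewrite exponent1; case: ifP.
- by rewrite zpow_succ exponent_gen IH; case: ifP.
- rewrite zpow_pred exponentM exponentV exponent_of_gen IH.
  by case: ifP => _ /=; rewrite ?oppr0 ?addr0.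
Qed.

End Exponent.

(** * Extending functions from the vertices to the complex *)

Section Height.
(** A function h on the vertices that changes only along the edges labelled w,
    with a slope k that is the same on the two w-edges of a square, is affine on
    each cube.  Exponents and lamps are both of this kind. *)
Variables (R : realType) (G : sgraph) (w : G) (h k : raag G -> R).
Hypothesis hM : forall g v, h (g * gen v)%g = h g + (v == w)%:R * k g.
Hypothesis kM : forall g v, adj v w -> k (g * gen v)%g = k g.
Hypothesis k1 : forall g, `|k g| <= 1.
Implicit Types (g : raag G) (x y : salvetti R G) (s : {ffun G -> R}).

Lemma slope_clique (r : seq G) (s : pred G) g :
  (forall v, v \in r -> s v -> adj v w) ->
  k (g * \big[*%g/1%g]_(v <- r | s v) gen v)%g = k g.
Proof.
elim: r g => [|v r IH] g sw; first by rewrite big_nil mulg1.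
rewrite big_cons; case: ifP => sv.
  by rewrite mulgA IH ?kM ?sw ?mem_head // => u ur; apply: sw; rewrite inE ur orbT.
by apply: IH => u ur; apply: sw; rewrite inE ur orbT.
Qed.

(** The edge labelled w contributes k g whatever precedes it in the product:
    the other generators of the clique are adjacent to w and leave k
    unchanged. *)
Lemma height_clique (s : {set G}) g : clique s ->
  h (g * gen_prod s)%g = h g + (w \in s)%:R * k g.
Proof.
move=> cs; rewrite /gen_prod.
suff H (r : seq G) g0 : uniq r ->
    h (g0 * \big[*%g/1%g]_(v <- r | v \in s) gen v)%g =
    h g0 + ((w \in r) && (w \in s))%:R * k g0.
  by rewrite H ?index_enum_uniq // mem_index_enum.
elim: r g0 => [|v r IH] g0 /=; first by rewrite big_nil mulg1 mul0r addr0.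
move=> /andP[vr ur]; rewrite big_cons inE [w == v]eq_sym.
case: ifP => vs; last first.
  by rewrite IH //; case: eqP => [<-|//]; rewrite vs !andbF.
rewrite mulgA IH // hM; case: eqP => [<-|/eqP vw] /=.
  by rewrite (negbTE vr) vs mul0r addr0.
rewrite mul0r addr0; case: andP => [[_ ws]|_]; last by rewrite !mul0r.
rewrite kM //.
by move/forall_inP: cs => /(_ v vs)/forall_inP/(_ w ws)/implyP; exact.
Qed.

(** The affine extension of h, read off from the minimal vertex of the cube
    containing x in its interior. *)
Definition height x : R := h (base x) + k (base x) * coord x w.

Lemma ones_sub (c : {set G}) s : in_cube c s -> ones s \subset c.
Proof.
move=> hs; apply/fintype.subsetP => v; rewrite inE => /eqP s1.
apply/negPn/negP => vs; have [_ /(_ vs)/eqP] := hs v.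
by rewrite s1 oner_eq0.
Qed.

Lemma sub_clique (c d : {set G}) : clique c -> d \subset c -> clique d.
Proof.
move=> /forall_inP cc /fintype.subsetP dc; apply/forall_inP => u ud.
by apply/forall_inP => v vd; move/forall_inP: (cc u (dc _ ud)); apply; exact: dc.
Qed.

(** The point x may lie in a proper face of the cube at g, where its base is no
    longer g; affinity makes the formula independent of this choice. *)
Lemma height_cube g (c : {set G}) s x : clique c -> in_cube c s ->
  cube_pt g s x -> height x = h g + k g * s w.
Proof.
move=> cc hs [bx cx]; rewrite /height cx bx.
have co := sub_clique cc (ones_sub hs).
rewrite height_clique // inE; case: eqP => [->|/eqP s1].
  by rewrite mul1r mulr0 mulr1 addr0.
rewrite mul0r addr0; have [->|s0] := eqVneq (s w) 0; first by rewrite !mulr0.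
rewrite slope_clique // => v _; rewrite inE => /eqP sv.
have wc : w \in c by apply/negPn/negP => wc; move/eqP: s0; apply; exact: (hs w).2.
have vc : v \in c.
  by apply: (fintype.subsetP (ones_sub hs)); rewrite inE sv.
move/forall_inP: cc => /(_ v vc)/forall_inP/(_ w wc)/implyP; apply.
by apply/eqP => vw; move/eqP: s1; rewrite -vw.
Qed.

(** Inside one cube the variation is at most that of the coordinate w, hence at
    most the Euclidean distance; summing over the steps of a string bounds the
    variation by the length of the string. *)
Lemma height_lip x y : `|height x - height y| <= sdist x y.
Proof.
apply/ler_addgt0Pr => e e0; have [L hL /ltW Le] := sdist_string x y e0.
apply: le_trans Le.
elim: hL => [z|{}x {}y z r {}L st _ IH]; first by rewrite subrr normr0.
rewrite -(subrKA (height y)) (le_trans (ler_normD _ _)) // lerD //.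
have [g [c [s [t [cc [hs ht] hx hy ->]]]]] := st.
rewrite (height_cube cc hs hx) (height_cube cc ht hy) opprD addrACA subrr add0r.
rewrite -mulrBr normrM; apply: le_trans (le_eucl_dist s t w).
by rewrite ler_piMl.
Qed.

End Height.

(** * Coordinates, and distances between vertices *)

Section Position.
Variables (R : realType) (G : sgraph).
Implicit Types (x y z : salvetti R G) (g : raag G) (v : G).

Definition pos x v : R := (exponent v (base x))%:~R + coord x v.

Lemma pos_lip x y v : `|pos x v - pos y v| <= sdist x y.
Proof.
have := @height_lip R G v (fun g => (exponent v g)%:~R) (fun=> 1) _ _ _ x y.
rewrite /height /pos !mul1r; apply => //.
- by move=> g u; rewrite exponent_gen rmorphD /= mulr1; case: (u == v).
- by move=> g; rewrite normr1.
Qed.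

Lemma exponent_base x v : exponent v (base x) = Num.floor (pos x v).
Proof.
apply/esym/floor_def; have /andP[c0 c1] := coordP x v.
by rewrite /pos intrD lerDl ltrD2l c0.
Qed.

Lemma pos_vertex g v : pos (vertex_pt R g) v = (exponent v g)%:~R.
Proof. by rewrite /pos /coord /= ffunE addr0. Qed.

Lemma eucl_dist_le_sum (s t : {ffun G -> R}) :
  eucl_dist s t <= \sum_v `|s v - t v|.
Proof.
have S0 (r : seq G) : 0 <= \sum_(v <- r) `|s v - t v| by apply: sumr_ge0.
rewrite -[leRHS]ger0_norm // -sqrtr_sqr ler_wsqrtr //.
elim: (index_enum G) => [|v r IH]; first by rewrite !big_nil expr0n.
rewrite !big_cons [leRHS]sqrrD real_normK ?num_real // -addrA lerD2l.
apply: le_trans IH _; rewrite lerDr mulrn_wge0 // mulr_ge0 //.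
Qed.

Lemma sdist_vertex x : sdist x (vertex_pt R (base x)) <= #|G|%:R.
Proof.
apply: (@le_trans _ _ (eucl_dist (coord x) [ffun=> 0])).
  apply/sdist_le/string1.
  exists (base x), [set v | coord x v != 0]%SET, (coord x), [ffun=> 0].
  split=> //; first exact: clique_supp.
  - split=> v; last by rewrite ffunE lexx ler01.
    have /andP[-> /ltW ->] := coordP x v; split=> //.
    by rewrite inE negbK => /eqP.
  - exact: cube_pt_self.
  - exact: (cube_pt_self (vertex_pt R (base x))).
apply: le_trans (eucl_dist_le_sum _ _) _.
rewrite -sum1_card natr_sum ler_sum // => v _.
by have /andP[c0 /ltW] := coordP x v; rewrite ffunE subr0 ger0_norm.
Qed.

Lemma sdist_edge g v : sdist (vertex_pt R g) (vertex_pt R (g * gen v)%g) <= 1.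
Proof.
pose t : {ffun G -> R} := [ffun w => (w == v)%:R].
have -> : 1 = eucl_dist [ffun=> 0] t.
  rewrite /eucl_dist (bigD1 v) //= !ffunE eqxx sub0r sqrrN expr1n big1.
    by rewrite addr0 sqrtr1.
  by move=> u /negbTE uv; rewrite !ffunE uv subrr expr0n.
apply/sdist_le/string1; exists g, [set v]%SET, [ffun=> 0], t; split=> //.
- apply/forall_inP => u; rewrite inE => /eqP ->.
  by apply/forall_inP => w; rewrite inE => /eqP ->; rewrite eqxx.
- split=> w; rewrite !ffunE ?lexx ?ler01 // inE.
  by case: eqP => _; rewrite ?lexx ?ler01.
- exact: (cube_pt_self (vertex_pt R g)).
- split=> [|w].
    rewrite (_ : ones t = [set v]%SET) ?gen_prod1 //.
    apply/setP => w; rewrite !inE ffunE.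
    by case: (w == v); rewrite ?eqxx // eq_sym oner_eq0.
  rewrite !ffunE; case: (w == v); rewrite ?eqxx //.
  by rewrite eq_sym oner_eq0.
Qed.

Lemma sdist_expg g v (n : nat) :
  sdist (vertex_pt R g) (vertex_pt R (g * gen v ^+ n)%g) <= n%:R.
Proof.
elim: n => [|n IH]; first by rewrite mulg1 sdistxx.
rewrite expgSr mulgA -natr1.
apply: le_trans (sdist_triangle (vertex_pt R (g * gen v ^+ n)%g) _ _) _.
by rewrite lerD ?sdist_edge.
Qed.

Lemma sdist_zpow g v (n : int) :
  sdist (vertex_pt R g) (vertex_pt R (g * zpow (gen v) n)%g) <= `|n|%:~R.
Proof.
case: n => n; first exact: sdist_expg.
rewrite sdist_sym -{2}[g](mulgVK (gen v ^+ n.+1)%g) /=.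
exact: sdist_expg.
Qed.

(** The path along the line gives the upper bound, the coordinate [pos] of
    label v the lower one: standard geodesics are geodesics. *)
Lemma sdist_zpow_eq g v (m n : int) :
  sdist (vertex_pt R (g * zpow (gen v) m)%g)
        (vertex_pt R (g * zpow (gen v) n)%g) = `|m - n|%:~R.
Proof.
apply/eqP; rewrite eq_le; apply/andP; split.
  rewrite distrC; have := sdist_zpow (g * zpow (gen v) m)%g v (n - m).
  by rewrite -mulgA -zpowD subrKC.
apply: le_trans (pos_lip _ _ v).
rewrite !pos_vertex !exponentM !exponent_zpow eqxx -intrB intr_norm.
by rewrite opprD addrACA subrr add0r.
Qed.

Lemma line_isom g v : isom_int (line_vertices (@std_line R G g v))
  (fun n => vertex_pt R (g * zpow (gen v) n)%g).
Proof.
split; last exact: sdist_zpow_eq.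
apply/seteqP; split=> [_ [n _ <-]|x [[[n bx] _] cx]].
  split=> [|u]; last by rewrite /coord /= ffunE.
  split=> [|u _]; last by rewrite /coord /= ffunE.
  case: n => n; first by exists n; left.
  by exists n.+1; right.
have E h : base x = h -> x = vertex_pt R h.
  by move=> xh; apply: salvetti_eq => //; apply/ffunP => u; rewrite cx /coord /= ffunE.
case: bx => /E ->; first by exists (Posz n).
case: n => [|n]; last by exists (Negz n).
by exists 0 => //; rewrite invg1.
Qed.

End Position.

(** * The lamplighter obstruction to polynomial growth *)

Section Track.
Variables (G : sgraph) (v w : G).

(** The lamplighter walks along 0, 1, ..., m - 1 and sets lamp i to a i. *)
Definition track (a : nat -> nat) (m : nat) : raag G :=
  (\prod_(0 <= i < m) (gen w ^+ a i * gen v))%g.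

Lemma sdist_track (R : realType) a m :
  sdist (vertex_pt R (track a m)) (vertex_pt R (1%g : raag G))
    <= (\sum_(0 <= i < m) a i + m)%:R.
Proof.
elim: m => [|m IH]; first by rewrite /track !big_geq // sdistxx.
rewrite /track !big_nat_recr //= mulgA -/(track a m).
apply: le_trans (sdist_triangle (vertex_pt R (track a m * gen w ^+ a m)%g) _ _) _.
have := sdist_edge R (track a m * gen w ^+ a m)%g v; rewrite sdist_sym => e1.
apply: le_trans (lerD e1 (sdist_triangle (vertex_pt R (track a m)) _ _)) _.
have := sdist_expg R (track a m) w (a m); rewrite sdist_sym => e2.
apply: le_trans (lerD (lexx _) (lerD e2 IH)) _.
by rewrite -natrD [X in X + _](_ : _ = 1%:R) // -natrD ler_nat; lia.
Qed.

End Track.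

Section Lamps.
Variables (G : sgraph) (v w : G).
Hypotheses (vw : v != w) (nvw : ~~ adj v w).
Implicit Types (g : raag G) (u : G) (i : int).

(** The action of the lamplighter group, seen only through lamp i and the
    position of the lamplighter: together they suffice to follow lamp i. *)
Definition lamp_fwd i u (s : int * int) : int * int :=
  (s.1 + ((u == w) && (s.2 == i))%:Z, s.2 + (u == v)%:Z).

Definition lamp_bwd i u (s : int * int) : int * int :=
  (s.1 - ((u == w) && (s.2 == i))%:Z, s.2 - (u == v)%:Z).

Let wv0 : (w == v)%:Z = 0.
Proof. by rewrite eq_sym (negbTE vw). Qed.

Let fwdK i u : cancel (lamp_fwd i u) (lamp_bwd i u).
Proof.
case=> a p; rewrite /lamp_bwd /lamp_fwd /=; have [->|_] := eqVneq u w.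
  by rewrite wv0; congr (_, _); lia.
by congr (_, _); lia.
Qed.

Let bwdK i u : cancel (lamp_bwd i u) (lamp_fwd i u).
Proof.
case=> a p; rewrite /lamp_bwd /lamp_fwd /=; have [->|_] := eqVneq u w.
  by rewrite wv0; congr (_, _); lia.
by congr (_, _); lia.
Qed.

(** Only v and w fail to act by commuting maps, and they are not adjacent. *)
Let fwdC i u1 u2 : adj u1 u2 ->
  forall s, lamp_fwd i u1 (lamp_fwd i u2 s) = lamp_fwd i u2 (lamp_fwd i u1 s).
Proof.
move=> uu [a p]; rewrite /lamp_fwd /=; congr (_, _); last exact: addrAC.
have [e1|n1] := eqVneq u1 w; have [e2|n2] := eqVneq u2 w => /=; last by lia.
- by move: uu; rewrite e1 e2 adj_irr.
- have [e|_] := eqVneq u2 v; last by lia.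
  by move: nvw; rewrite -e -e1 adj_sym uu.
- have [e|_] := eqVneq u1 v; last by lia.
  by move: nvw; rewrite -e -e2 uu.
Qed.

Definition lamp i g : int * int := raag_act (lamp_fwd i) (lamp_bwd i) (0, 0) g.

Lemma lamp1 i : lamp i 1%g = (0, 0).
Proof. exact: (raag_act1 (@fwdK i) (@bwdK i) (@fwdC i)). Qed.

Lemma lamp_gen i g u : lamp i (g * gen u)%g = lamp_fwd i u (lamp i g).
Proof.
by rewrite /lamp (raag_actM (@fwdK i) (@bwdK i) (@fwdC i))
  (raag_act_gen (@fwdK i) (@bwdK i) (@fwdC i)).
Qed.

(** Lighting lamp 0 before or after leaving it makes a difference. *)
Lemma not_commute_gen : ~ commute (gen v) (gen w).
Proof.
have lg u : lamp 0 (gen u) = lamp_fwd 0 u (0, 0).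
  by rewrite -[gen u]mul1g lamp_gen lamp1.
move=> /(congr1 (fun g => (lamp 0 g).1)); rewrite !lamp_gen !lg /lamp_fwd /=.
by rewrite !eqxx wv0 (negbTE vw).
Qed.

(** The value of lamp i changes only along w-edges, when the lamplighter stands
    at i; his position changes only along v-edges, which never span a square
    with a w-edge. *)
Lemma lamp_lip (R : realType) i (g h : raag G) :
  `|((lamp i g).1 - (lamp i h).1)%:~R| <= sdist (vertex_pt R g) (vertex_pt R h).
Proof.
have := @height_lip R G w (fun g => ((lamp i g).1)%:~R)
  (fun g => ((lamp i g).2 == i)%:R) _ _ _ (vertex_pt R g) (vertex_pt R h).
rewrite /height /coord /= !ffunE !mulr0 !addr0 intrB; apply.
- move=> f u; rewrite lamp_gen /= rmorphD /=; congr (_ + _).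
  by case: (u == w); case: (_ == i); rewrite /= ?mulr1 ?mulr0 ?mul0r.
- move=> f u uw; rewrite lamp_gen /=; have [uv|_] := eqVneq u v.
    by move: nvw; rewrite -uv uw.
  by congr (nat_of_bool _)%:R; lia.
- by move=> f; case: (_ == i); rewrite ?normr0 ?normr1.
Qed.

Lemma lamp_expg i g n :
  lamp i (g * gen w ^+ n)%g =
  ((lamp i g).1 + ((lamp i g).2 == i)%:Z * n%:Z, (lamp i g).2).
Proof.
elim: n => [|n IH]; first by rewrite mulg1 mulr0 addr0 -surjective_pairing.
rewrite expgSr mulgA lamp_gen IH /lamp_fwd /= eqxx /=.
rewrite wv0 addr0; congr (_, _); lia.
Qed.

Lemma lamp_track (i : nat) a m :
  lamp i (track v w a m) = (if (i < m)%N then (a i)%:Z else 0, m%:Z).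
Proof.
elim: m => [|m IH]; first by rewrite /track big_geq // lamp1.
rewrite /track big_nat_recr //= mulgA lamp_gen lamp_expg -/(track v w a m) IH.
rewrite /lamp_fwd /= (negbTE vw) eqxx /= addr0; congr (_, _); last by lia.
have -> : (m%:Z == i%:Z) = (m == i) by lia.
have [->|ne] := eqVneq m i; first by rewrite ltnn ltnSn; lia.
by rewrite ltnS [(i <= m)%N]leq_eqVlt [i == m]eq_sym (negbTE ne) /=; lia.
Qed.

End Lamps.

(** * Complete graphs: the Salvetti complex as a Euclidean space *)

Definition complete (G : sgraph) : Prop := forall u v : G, u != v -> adj u v.

Definition vec (G : sgraph) (a : G -> int) : raag G :=
  (\prod_v zpow (gen v) (a v))%g.

Lemma exponent_vec (G : sgraph) (a : G -> int) w : exponent w (vec a) = a w.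
Proof.
rewrite /vec (big_morph _ (exponentM w) (exponent1 w)) (bigD1 w) //=.
rewrite exponent_zpow eqxx big1 ?addr0 // => v /negbTE vw.
by rewrite exponent_zpow vw.
Qed.

Lemma commutative_complete (G : sgraph) :
  (forall g h : raag G, commute g h) -> complete G.
Proof.
move=> cG u v uv; apply/negPn/negP => nuv.
exact: (not_commute_gen uv nuv).
Qed.

Section CompleteGroup.
Variable G : sgraph.
Hypothesis cG : complete G.
Implicit Types (g h : raag G) (a b : G -> int) (v : G).

Lemma commute_gen u v : commute (gen u) (gen v).
Proof.
have [->|uv] := eqVneq u v; first exact: commute_refl.
exact/gen_commute/cG.
Qed.

Lemma vecD a b : vec (fun v => a v + b v) = (vec a * vec b)%g.
Proof.
rewrite /vec -prodgM_commute => [|u v _ _].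
  by apply: eq_bigr => v _; rewrite zpowD.
by apply/commute_zpow/commute_sym/commute_zpow/commute_gen.
Qed.

Lemma vec_delta v : vec (fun u => (v == u)%:Z) = gen v.
Proof.
rewrite /vec -[RHS](@big_pred1_eq _ _ *%g _ v (@gen G)) big_mkcond.
by apply: eq_bigr => u _; rewrite /= eq_sym; case: eqP.
Qed.

(** Both sides change in the same way under right multiplication by a
    generator; this is where commutativity is used. *)
Lemma vec_exponent g : vec (fun u => exponent u g) = g.
Proof.
have S h v :
    vec (fun u => exponent u (h * gen v)%g) = (vec (fun u => exponent u h) * gen v)%g.
  rewrite -[in RHS](vec_delta v) -vecD; congr vec; apply/funext => u.
  exact: exponent_gen.
elim/raag_ind: g => [|g v IH|g v].
- by rewrite /vec big1 // => v _; rewrite exponent1.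
- by rewrite S IH.
- by rewrite S => /mulIg.
Qed.

Lemma exponent_inj g h : (forall v, exponent v g = exponent v h) -> g = h.
Proof.
by move=> gh; rewrite -(vec_exponent g) -(vec_exponent h); congr vec; apply/funext.
Qed.

End CompleteGroup.

Lemma complete_graph_complete n : complete (complete_graph n).
Proof. by []. Qed.

Lemma raag_complete_free_abelian n :
  free_abelian_of_rank n (raag (complete_graph n)).
Proof.
exists (fun g => \row_(i < n) exponent (i : complete_graph n) g).
  exists (fun r : 'rV[int]_n => vec (fun i : complete_graph n => r 0 i)) => [g|r].
    rewrite -[RHS](vec_exponent (@complete_graph_complete n)); congr vec.
    by apply/funext => i; rewrite mxE.
  by apply/rowP => i; rewrite mxE exponent_vec.
by move=> g h; apply/rowP => i; rewrite !mxE exponentM.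
Qed.

Lemma free_abelian_complete n (G : sgraph) :
  free_abelian_of_rank n (raag G) -> complete G.
Proof.
move=> [phi bphi phiM]; apply: commutative_complete => g h.
by apply: (bij_inj bphi); rewrite !phiM addrC.
Qed.

Section CompletePoints.
Variables (R : realType) (G : sgraph).
Hypothesis cG : complete G.
Local Notation X := (salvetti R G).
Implicit Types (x y : X) (r : G -> R).

Lemma clique_complete (s : {set G}) : clique s.
Proof.
by apply/forall_inP => u _; apply/forall_inP => v _; apply/implyP; exact: cG.
Qed.

Definition point_coords r : raag G * {ffun G -> R} :=
  (vec (fun v => Num.floor (r v)), [ffun v => r v - (Num.floor (r v))%:~R]).

Lemma is_point_coords r : is_point (point_coords r).
Proof.
apply/andP; split; last exact: clique_complete.
apply/forallP => v; rewrite ffunE subr_ge0 floor_le ltrBlDl.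
by rewrite -[X in _ + X](mulr1z 1) -intrD floorD1_gt.
Qed.

Definition point_of r : X := Point (is_point_coords r).

Lemma pos_point r v : pos (point_of r) v = r v.
Proof. by rewrite /pos /base /coord /= ffunE exponent_vec subrKC. Qed.

Lemma sdist_vec (g : raag G) (a : G -> int) :
  sdist (vertex_pt R g) (vertex_pt R (g * vec a)%g) <= \sum_v `|a v|%:~R.
Proof.
rewrite /vec; elim: (index_enum G) g => [|v s IH] g.
  by rewrite !big_nil mulg1 sdistxx.
rewrite !big_cons mulgA.
apply: le_trans (sdist_triangle (vertex_pt R (g * zpow (gen v) (a v))%g) _ _) _.
by apply: lerD; [exact: sdist_zpow|exact: IH].
Qed.

(** From x to the vertex [base x], along edges to [base y], and on to y.  The
    first and the last part cost #|G| each; a third #|G| is lost when the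
    exponents of the bases, the floors of the coordinates, are compared with the
    coordinates. *)
Lemma sdist_le_pos x y :
  sdist x y <= \sum_v `|pos x v - pos y v| + (3 * #|G|)%:R.
Proof.
pose a v := exponent v (base y) - exponent v (base x).
have ey : base y = (base x * vec a)%g.
  by apply: exponent_inj => // v; rewrite exponentM exponent_vec /a subrKC.
apply: le_trans (sdist_triangle (vertex_pt R (base x)) _ _) _.
have hx := sdist_vertex x; have := sdist_vertex y; rewrite sdist_sym => hy.
apply: le_trans (lerD hx (sdist_triangle (vertex_pt R (base y)) _ _)) _.
have : sdist (vertex_pt R (base x)) (vertex_pt R (base y)) <=
    \sum_v `|pos x v - pos y v| + #|G|%:R.
  rewrite ey; apply: le_trans (sdist_vec _ _) _.
  rewrite -sum1_card natr_sum -big_split /=; apply: ler_sum => v _.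
  rewrite /a intr_norm intrB /pos.
  have /andP[? ?] := coordP x v; have /andP[? ?] := coordP y v.
  rewrite ler_norml; set t := (X in `|X|).
  have := ler_norm t; have := ler_norm (- t); rewrite normrN /t.
  lra.
rewrite natrM; lra.
Qed.

End CompletePoints.

(** * Finite Hausdorff distance *)

Section Hausdorff.
Variables (R : realType) (X : metricType R).
Implicit Types (A B C : set X) (e d : R).

Lemma dHaus_le A B e : 0 <= e -> A `<=` nbhd e B -> B `<=` nbhd e A ->
  (dHaus A B <= e%:E)%E.
Proof. by move=> e0 AB BA; apply: ereal_inf_lbound; exists e. Qed.

Lemma dHaus_finP A B : (dHaus A B < +oo)%E <->
  exists e, [/\ 0 <= e, A `<=` nbhd e B & B `<=` nbhd e A].
Proof.
split=> [h|[e [e0 AB BA]]]; last first.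
  by apply: le_lt_trans (dHaus_le e0 AB BA) _; exact: ltry.
have /ereal_inf_lt[_ [e he <-] _] := h.
by exists e.
Qed.

Lemma dHaus_fin A B e : (dHaus A B <= e%:E)%E -> (dHaus A B < +oo)%E.
Proof. by move=> h; apply: le_lt_trans h _; exact: ltry. Qed.

Lemma dHaus_fin_refl A : (dHaus A A < +oo)%E.
Proof.
by apply/dHaus_finP; exists 0; split=> // x Ax; exists x => //; rewrite mdistxx.
Qed.

Lemma dHaus_fin_sym A B : (dHaus A B < +oo)%E -> (dHaus B A < +oo)%E.
Proof. by move=> /dHaus_finP[e [e0 AB BA]]; apply/dHaus_finP; exists e. Qed.

Lemma nbhd_trans A B C e d : A `<=` nbhd e B -> B `<=` nbhd d C ->
  A `<=` nbhd (e + d) C.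
Proof.
move=> AB BC x /AB[y /BC[z Cz yz] xy]; exists z => //.
by apply: le_trans (metric_triangle _ y _) _; rewrite lerD.
Qed.

Lemma dHaus_fin_trans B A C :
  (dHaus A B < +oo)%E -> (dHaus B C < +oo)%E -> (dHaus A C < +oo)%E.
Proof.
move=> /dHaus_finP[e [e0 AB BA]] /dHaus_finP[d [d0 BC CB]].
apply/dHaus_finP; exists (e + d); split; first exact: addr_ge0.
  exact: nbhd_trans AB BC.
by rewrite addrC; exact: nbhd_trans CB BA.
Qed.

Lemma coarse_classP A B :
  coarse_class A = coarse_class B <-> (dHaus A B < +oo)%E.
Proof.
split=> [AB|AB].
  have : coarse_class B B by exact: dHaus_fin_refl.
  by rewrite -AB.
apply/seteqP; split=> C; rewrite /coarse_class /=; apply: dHaus_fin_trans => //.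
exact: dHaus_fin_sym.
Qed.

End Hausdorff.

(** * Standard geodesics as coordinate lines *)

Section Flats.
Variables (R : realType) (G : sgraph).
Hypothesis cG : complete G.
Local Notation X := (salvetti R G).
Implicit Types (x y : X) (a b D : G -> R) (w u v : G) (l m : set X).

(** The line parallel to axis w through a.  The other coordinates may be
    arbitrary reals, unlike those of a standard geodesic, so that images of
    standard geodesics under the maps [stretch] are again of this form. *)
Definition flat a w : set X := [set x | forall v, v != w -> pos x v = a v].

Lemma pos_inj x y : (forall v, pos x v = pos y v) -> x = y.
Proof.
move=> xy; have bxy : base x = base y.
  by apply: exponent_inj => // v; rewrite !exponent_base xy.
apply: salvetti_eq => //; apply/ffunP => v.
by have := xy v; rewrite /pos bxy => /addrI.
Qed.

Lemma std_line_flat g w :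
  @std_line R G g w = flat (fun v => (exponent v g)%:~R) w.
Proof.
apply/seteqP; split=> x.
  move=> [[n bx] cx] v vw; rewrite /pos cx // addr0; congr _%:~R.
  have wv : (w == v) = false by rewrite eq_sym; exact/negbTE.
  case: bx => ->; rewrite exponentM.
    by rewrite (exponent_zpow v w n) wv addr0.
  by rewrite exponentV (exponent_zpow v w n) wv oppr0 addr0.
move=> xa; have ev v : v != w -> exponent v (base x) = exponent v g.
  by move=> vw; rewrite exponent_base xa // intrKfloor.
split=> [|v vw]; last first.
  by have := xa v vw; rewrite /pos ev // => /eqP; rewrite addrC -subr_eq0 addrK => /eqP.
have -> : base x = (g * zpow (gen w) (exponent w (base x) - exponent w g))%g.
  apply: exponent_inj => // v; rewrite exponentM exponent_zpow.
  by case: eqP => [<-|/eqP wv]; rewrite ?subrKC // addr0 ev // eq_sym.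
case: (_ - _) => n; first by exists n; left.
by exists n.+1; right.
Qed.

Lemma flat_sub_nbhd a b D w : (forall v, `|a v - b v| <= D v) ->
  flat a w `<=` nbhd (\sum_v D v + (3 * #|G|)%:R) (flat b w).
Proof.
move=> abD x xa.
exists (point_of cG (fun v => if v == w then pos x w else b v)).
  by move=> v vw; rewrite pos_point (negbTE vw).
apply: le_trans (sdist_le_pos cG _ _) _; rewrite lerD2r; apply: ler_sum => v _.
rewrite pos_point; have [->|vw] := eqVneq v w.
  by rewrite subrr normr0; apply: le_trans (abD w).
by rewrite xa.
Qed.

Lemma dHaus_flat a b D w : (forall v, `|a v - b v| <= D v) ->
  (dHaus (flat a w) (flat b w) <= (\sum_v D v + (3 * #|G|)%:R)%:E)%E.
Proof.
move=> abD; apply: dHaus_le.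
- by rewrite addr_ge0 //; apply: sumr_ge0 => v _; apply: le_trans (abD v).
- exact: flat_sub_nbhd.
- by apply: flat_sub_nbhd => v; rewrite distrC.
Qed.

Lemma dHaus_flat_fin a b w : (dHaus (flat a w) (flat b w) < +oo)%E.
Proof. exact: (dHaus_fin (@dHaus_flat a b _ w (fun v => lexx _))). Qed.

(** Along the first line coordinate w is unbounded, on a line of another
    direction it is constant. *)
Lemma flat_label a b w u : (dHaus (flat a w) (flat b u) < +oo)%E -> w = u.
Proof.
move=> /dHaus_finP[e [e0 ab _]]; apply/eqP/negPn/negP => wu.
pose x : X := point_of cG (fun v => if v == w then b w + e + 1 else a v).
have [|y yb xy] := ab x.
  by move=> v vw; rewrite pos_point (negbTE vw).
have := le_trans (pos_lip x y w) xy.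
by rewrite pos_point eqxx yb // ler_norml; lra.
Qed.

Lemma labelled_dHaus_fin w u l m : labelled w l -> labelled u m ->
  (dHaus l m < +oo)%E <-> w = u.
Proof.
move=> [g ->] [h ->]; rewrite !std_line_flat; split=> [/flat_label //|->].
exact: dHaus_flat_fin.
Qed.

Definition line_class w : set (set X) := [set l | labelled w l].

Lemma parallel_classE w l : labelled w l -> parallel_class l = line_class w.
Proof.
move=> wl; apply/seteqP; split=> m /=.
  by move=> [[u um]] /(labelled_dHaus_fin wl um) ->.
by move=> wm; split; [exists w|exact/(labelled_dHaus_fin wl wm)].
Qed.

Lemma line_class_inj : injective line_class.
Proof.
move=> w u wu; have w1 : labelled w (std_line 1%g w : set X) by exists 1%g.
have u1 : line_class u (std_line 1%g w) by rewrite -wu.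
exact/(labelled_dHaus_fin w1 u1)/dHaus_fin_refl.
Qed.

Lemma peripheralP (B : {set G}) F :
  peripheral R B F <-> exists2 w, w \in B & F = line_class w.
Proof.
split=> [[w [l [wB wl ->]]]|[w wB ->]]; first by exists w => //; exact: parallel_classE.
exists w, (std_line 1%g w); split=> //; first by exists 1%g.
by apply/esym/parallel_classE; exists 1%g.
Qed.

End Flats.

(** * Stretching the coordinates *)

Section Stretching.
Variables (R : realType) (G H : sgraph).
Hypotheses (cG : complete G) (cH : complete H).
Variables (s : G -> H) (t : H -> G).
Hypotheses (sK : cancel s t) (tK : cancel t s).
Variable lam : G -> R.
Hypothesis lam_gt0 : forall v, 0 < lam v.
Local Notation X := (salvetti R G).
Local Notation Y := (salvetti R H).
Implicit Types (x : X) (y : Y) (a : G -> R) (w v : G) (u : H).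

Definition stretch x : Y := point_of cH (fun u => lam (t u) * pos x (t u)).

Lemma pos_stretch x u : pos (stretch x) u = lam (t u) * pos x (t u).
Proof. exact: pos_point. Qed.

Lemma stretch_surj y : exists x, stretch x = y.
Proof.
exists (point_of cG (fun v => (lam v)^-1 * pos y (s v))).
apply: pos_inj => // u; rewrite pos_stretch pos_point tK mulVKf //.
by rewrite gt_eqF.
Qed.

Lemma stretch_flat a w :
  stretch @` flat a w = flat (fun u => lam (t u) * a (t u)) (s w).
Proof.
apply/seteqP; split=> [_ [x xa <-] u uw|y ya].
  by rewrite pos_stretch xa //; apply: contraNneq uw => <-; rewrite tK.
have [x xy] := stretch_surj y; exists x => // v vw.
have sv : s v != s w by rewrite (can_eq sK).
have := ya (s v) sv; rewrite -xy pos_stretch sK => /mulfI; apply.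
by rewrite gt_eqF.
Qed.

(* One additive constant for all purposes: 3 #|G| and 3 #|H| are the errors of
   sdist_le_pos, the sum and a further #|H| come from rounding the coordinates
   of lines to integers, before and after stretching. *)
Let A : R := \sum_u lam (t u) + (4 * #|H|)%:R + (3 * #|G|)%:R.
Let K : R := 1 + \sum_u lam (t u) + \sum_v (lam v)^-1.

Lemma stretch_qi : is_quasi_isometry K A stretch.
Proof.
have l0 : 0 <= \sum_u lam (t u) by apply: sumr_ge0 => u _; exact: ltW.
have i0 : 0 <= \sum_v (lam v)^-1 by apply: sumr_ge0 => v _; rewrite invr_ge0 ltW.
have nG : 0 <= (3 * #|G|)%:R :> R by [].
have nH : 0 <= #|H|%:R :> R by [].
have E : A = \sum_u lam (t u) + 4 * #|H|%:R + (3 * #|G|)%:R.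
  by rewrite /A natrM.
have K1 : 1 <= K by rewrite /K; lra.
have A0 : 0 <= A by rewrite E; lra.
split=> // [x y|y]; last first.
  by have [x <-] := stretch_surj y; exists x; rewrite mdistxx.
change (K^-1 * sdist x y - A <= sdist (stretch x) (stretch y) <= K * sdist x y + A).
have d0 := sdist_ge0 x y; have d0' := sdist_ge0 (stretch x) (stretch y).
apply/andP; split.
  have h : sdist x y <= K * sdist (stretch x) (stretch y) + (3 * #|G|)%:R.
    apply: le_trans (sdist_le_pos cG _ _) _; rewrite lerD2r.
    apply: (@le_trans _ _ (\sum_v (lam v)^-1 * sdist (stretch x) (stretch y))).
      apply: ler_sum => v _; have := pos_lip (stretch x) (stretch y) (s v).
      rewrite !pos_stretch sK -mulrBr normrM (gtr0_norm (lam_gt0 v)) => h.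
      by rewrite -(ler_pM2l (lam_gt0 v)) mulVKf // gt_eqF.
    by rewrite -mulr_suml ler_wpM2r // /K; lra.
  rewrite lerBlDr -(ler_pM2l (lt_le_trans ltr01 K1)) mulVKf; last first.
    by rewrite gt_eqF // (lt_le_trans ltr01).
  apply: le_trans h _; rewrite mulrDr lerD2l.
  apply: (@le_trans _ _ A); first by rewrite E; lra.
  by rewrite ler_peMl.
apply: le_trans (sdist_le_pos cH _ _) _.
apply: lerD; last by rewrite E !natrM; lra.
apply: (@le_trans _ _ (\sum_u lam (t u) * sdist x y)).
  apply: ler_sum => u _; rewrite !pos_stretch -mulrBr normrM.
  by rewrite (gtr0_norm (lam_gt0 _)) ler_pM2l // pos_lip.
by rewrite -mulr_suml ler_wpM2r // /K; lra.
Qed.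

Lemma floor_dist (r : R) : `|r - (Num.floor r)%:~R| <= 1.
Proof. by have := floor_itv r; rewrite intrD ler_norml; lra. Qed.

(** The image of a standard geodesic under [stretch] is a coordinate line, whose
    other coordinates must be rounded to reach a standard geodesic. *)
Definition image_line (g : raag G) w : set Y :=
  std_line (vec (fun u => Num.floor (lam (t u) * (exponent (t u) g)%:~R))) (s w).

Lemma sum_const (c : R) : \sum_(u : H) c = #|H|%:R * c.
Proof. by rewrite sumr_const mulr_natl. Qed.

Lemma dHaus_image_line g w :
  (dHaus (stretch @` std_line g w) (image_line g w) <= A%:E)%E.
Proof.
rewrite /image_line !std_line_flat // stretch_flat.
have := @dHaus_flat R H cH (fun u => lam (t u) * (exponent (t u) g)%:~R)
  (fun u => (exponent u
    (vec (fun u => Num.floor (lam (t u) * (exponent (t u) g)%:~R))))%:~R)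
  (fun=> 1) (s w).
move=> /(_ _)/le_trans; apply; first by move=> u; rewrite exponent_vec floor_dist.
rewrite lee_fin sum_const /A !natrM.
have l0 : 0 <= \sum_u lam (t u) by apply: sumr_ge0 => u _; exact: ltW.
by have : 0 <= #|G|%:R :> R by []; lra.
Qed.

(** To hit a given line up to bounded error, divide its coordinates by the
    stretch factors and round.  Stretching multiplies the rounding errors by the
    factors, whence the sum of the factors in the constant. *)
Lemma line_near_image h w : exists g,
  (dHaus (stretch @` std_line g w) (std_line h (s w)) <= A%:E)%E.
Proof.
pose q v : R := (lam v)^-1 * (exponent (s v) h)%:~R.
exists (vec (fun v => Num.floor (q v))); rewrite !std_line_flat // stretch_flat.
have := @dHaus_flat R H cH
  (fun u => lam (t u) * (exponent (t u) (vec (fun v => Num.floor (q v))))%:~R)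
  (fun u => (exponent u h)%:~R) (fun u => lam (t u)) (s w).
move=> /(_ _)/le_trans; apply; last first.
  rewrite lee_fin /A !natrM.
  by have : 0 <= #|G|%:R :> R by []; have : 0 <= #|H|%:R :> R by []; lra.
move=> u; rewrite exponent_vec.
have -> : (exponent u h)%:~R = lam (t u) * q (t u).
  by rewrite /q tK mulVKf // gt_eqF.
rewrite -mulrBr normrM (gtr0_norm (lam_gt0 _)) -[leRHS]mulr1 ler_pM2l // distrC.
exact: floor_dist.
Qed.

Lemma stretch_relative (P : set (set (set X))) (Q : set (set (set Y))) fs :
  set_bij P Q fs ->
  (forall F, P F -> exists2 w, F = line_class w & fs F = line_class (s w)) ->
  relative_quasi_isometry P Q stretch fs.
Proof.
move=> bij Pfs; split=> //; exists K, A; split; first exact: stretch_qi.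
move=> F /Pfs[w -> ->]; split=> [_ [g ->]|_ [h ->]].
  by exists (image_line g w); [eexists|exact: dHaus_image_line].
by have [g hg] := line_near_image h w; exists (std_line g w) => //; exists g.
Qed.

(** At the point with parameter n the target line has coordinate floor (q n),
    up to the initial offset, and the stretched point q n.  Two floors are taken
    in that coordinate and one in each other, so every coordinate is off by at
    most 2. *)
Lemma stretch_str g w (q : rat) : lam w = ratr q -> 0 < q ->
  has_str_at stretch (std_line g w) (image_line g w) (5 * #|H|%:R) q.
Proof.
move=> lw q0; split=> //.
eexists _, _, false, 0; split; [exact: line_isom|exact: line_isom|move=> n].
rewrite expr0 mul1r addr0; apply: le_trans (sdist_le_pos cH _ _) _.
have -> : 5 * #|H|%:R = \sum_(u : H) 2 + (3 * #|H|)%:R :> R.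
  by rewrite sum_const natrM; lra.
rewrite lerD2r; apply: ler_sum => u _.
rewrite pos_stretch !pos_vertex !exponentM exponent_vec !exponent_zpow.
rewrite -[s w == u](can_eq tK) sK.
have fl := floor_itv (lam (t u) * (exponent (t u) g)%:~R); rewrite intrD in fl.
have [e|_] := eqVneq w (t u); last by rewrite !addr0 ler_norml; lra.
have : (Num.floor (q * n%:~R))%:~R <= lam (t u) * n%:~R <
    (Num.floor (q * n%:~R))%:~R + (1 : R).
  rewrite -e lw; have := floor_itv (q * n%:~R).
  rewrite -(ler_rat R) -(ltr_rat R) !rmorphM /= !ratr_int intrD.
  by [].
rewrite !intrD mulrDr ler_norml; lra.
Qed.

End Stretching.

(** * Uniqueness of stretch factors, and F-geodesics *)

Section StretchFactor.
Variables (R : realType) (G H : sgraph).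
Implicit Types (f : salvetti R G -> salvetti R H) (q : rat).

(** Having stretch factor q is a statement about distances, in which the
    identifications with the integers and the target line no longer occur. *)
Lemma has_str_dist f l m q : has_str f l m q -> exists C : R,
  forall x y, line_vertices l x -> line_vertices l y ->
  `|sdist (f x) (f y) - ratr q * sdist x y| <= C.
Proof.
move=> [C [C0 q0 [phi [psi [s [b [[rphi dphi] [_ dpsi] hC]]]]]]].
exists (2 * C + 1) => x y; rewrite -rphi => -[i _ <-] [j _ <-].
pose p (n : int) := psi ((-1) ^+ s * Num.floor (q * n%:~R) + b).
have hp n : sdist (f (phi n)) (p n) <= C by exact: hC.
have dp : sdist (p i) (p j) =
    `|(Num.floor (q * i%:~R))%:~R - (Num.floor (q * j%:~R))%:~R|.
  rewrite [LHS]dpsi opprD addrACA subrr addr0 -mulrBr normrM normrX normrN1.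
  by rewrite expr1n mul1r intr_norm intrB.
rewrite [sdist (phi i) _]dphi intr_norm intrB.
have fl n : (Num.floor (q * n%:~R))%:~R <= (ratr q * n%:~R : R) <
    (Num.floor (q * n%:~R))%:~R + (1 : R).
  have := floor_itv (q * n%:~R).
  by rewrite -(ler_rat R) -(ltr_rat R) !rmorphM /= !ratr_int intrD.
have := fl i; have := fl j; move: dp.
have e : ratr q * `|i%:~R - j%:~R| = `|ratr q * i%:~R - ratr q * j%:~R| :> R.
  by rewrite -mulrBr normrM (gtr0_norm (_ : 0 < ratr q)) // ltr0q.
rewrite e; set a := ratr q * i%:~R; set c := ratr q * j%:~R => dp fj fi.
have t1 := sdist_triangle (p i) (f (phi i)) (f (phi j)).
have t2 := sdist_triangle (p j) (p i) (f (phi j)).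
have t3 := sdist_triangle (f (phi i)) (p i) (p j).
have t4 := sdist_triangle (f (phi j)) (f (phi i)) (p j).
have hi := hp i; have hj := hp j.
have hi' := hp i; have hj' := hp j; rewrite sdist_sym in hi'; rewrite sdist_sym in hj'.
have : `|sdist (p i) (p j) - `|a - c| | <= 1.
  rewrite dp; apply: le_trans (ler_dist_dist _ _) _; rewrite ler_norml; lra.
rewrite !ler_norml; lra.
Qed.

Lemma str_unique f g w m m' q q' :
  has_str f (std_line g w) m q -> has_str f (std_line g w) m' q' -> q = q'.
Proof.
move=> /has_str_dist[C hC] /has_str_dist[C' hC'].
apply/eqP/negPn/negP => qq.
pose d : R := `|ratr q - ratr q'|.
have d0 : 0 < d by rewrite normr_gt0 subr_eq0 (inj_eq (fmorph_inj _)).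
have [n hn] : exists n : nat, C + C' < d * n%:R.
  exists (Num.bound `|(C + C') / d|); rewrite mulrC -ltr_pdivrMr //.
  by apply: le_lt_trans (ler_norm _) _; apply: archi_boundP.
have [rl dl] := line_isom R g w.
pose x z := vertex_pt R (g * zpow (gen w) z)%g.
have xl z : line_vertices (std_line g w) (x z) by rewrite -rl; exists z.
have := hC _ _ (xl n%:Z) (xl 0); have := hC' _ _ (xl n%:Z) (xl 0).
have -> : sdist (x n%:Z) (x 0) = n%:R by rewrite [LHS]dl subr0.
set D := sdist _ _ => h' h.
have : d * n%:R <= C' + C.
  rewrite -[n%:R]ger0_norm // -normrM mulrBl.
  have -> : ratr q * n%:R - ratr q' * n%:R =
    (D - ratr q' * n%:R) - (D - ratr q * n%:R) by lra.
  by apply: le_trans (ler_normB _ _) (lerD h' h).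
lra.
Qed.

End StretchFactor.

(** Stretching all coordinates by 1, the identity, or by 2 gives maps that
    preserve the class of l, with stretch factors 1 and 2. *)
Lemma complete_F_geodesic (R : realType) (G : sgraph) (l : set (salvetti R G)) :
  complete G -> std_geodesic l -> F_geodesic l.
Proof.
move=> cG sl; split=> // -[_ Rl]; have [w [g lE]] := sl.
pose f (c : R) := stretch cG id (fun=> c).
have bf (c : R) : 0 < c -> based_quasi_isometry (f c) l l.
  move=> c0; split.
    by eexists _, _; exact: (@stretch_qi _ _ _ cG cG id id _ _ (fun=> c)).
  apply/coarse_classP; rewrite lE std_line_flat //.
  by rewrite (@stretch_flat _ _ _ cG cG id id) //; exact: dHaus_flat_fin.
have fs (q : rat) : 0 < q -> exists m, has_str (f (ratr q)) l m q.
  move=> q0; rewrite lE; eexists; eexists.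
  by apply: (stretch_str cG (s := id) (t := id)) q0.
have q1 : 0 < 1 :> rat by [].
have q2 : 0 < 2 :> rat by [].
have [||r [r1 r2]] := Rl G l (f (ratr 1)) (f (ratr 2)) sl.
- by apply: bf; rewrite ltr0q.
- by apply: bf; rewrite ltr0q.
have [m1 h1] := fs 1 q1; have [m2 h2] := fs 2 q2.
rewrite lE in h1 h2 r1 r2.
by have := str_unique r1 h1; rewrite (str_unique r2 h2).
Qed.

(** * Growth: the quasi-isometry type determines the graph *)

(** Restricting the parameters to multiples of D + 1 makes sigma injective.  The
    (N + 1)^j parameters with entries at most N (D + 1) then have distinct images
    in a box of side O(N) in Z^T, which for large N forces j <= #|T|. *)
Lemma lattice_dim (T : finType) (j C D : nat) (sigma : (nat -> nat) -> T -> int) :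
  (forall a N, (forall i, a i <= N)%N -> forall v, (`|sigma a v| <= C * N.+1)%N) ->
  (forall a b, sigma a =1 sigma b -> forall i, (i < j)%N -> (a i <= b i + D)%N) ->
  (j <= #|T|)%N.
Proof.
move=> bound sep; rewrite leqNgt; apply/negP => Tj.
(* E (N + 1) bounds the side of the box, and N is taken so large that
   (N + 1)^(k + 1) > (E (N + 1))^k with k = #|T|. *)
pose E := (2 * C * D.+1).+1.
pose N := (E ^ #|T|)%N.
pose emb (c : {ffun 'I_j -> 'I_N.+1}) (i : nat) : nat :=
  oapp (fun o : 'I_j => D.+1 * c o)%N 0%N (insub i).
have embE c (o : 'I_j) : emb c o = (D.+1 * c o)%N by rewrite /emb valK.
have emb_le c i : (emb c i <= D.+1 * N)%N.
  by rewrite /emb; case: insub => //= o; rewrite leq_mul // -ltnS ltn_ord.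
pose L := (C * (D.+1 * N).+1)%N.
have sL c v : (`|sigma (emb c) v| <= L)%N by apply: bound.
pose F (c : {ffun 'I_j -> 'I_N.+1}) : {ffun T -> 'I_(2 * L).+1} :=
  [ffun v => inord `|sigma (emb c) v + L%:Z|].
have F_inj : injective F.
  move=> b c bc.
  have sbc : sigma (emb b) =1 sigma (emb c).
    move=> v; have /(congr1 val) := congr1 (fun f : {ffun _} => f v) bc.
    have := sL b v; have := sL c v; rewrite !ffunE /= => ? ?.
    by rewrite !inordK; lia.
  apply/ffunP => o; apply/val_inj => /=.
  have h1 := sep _ _ sbc o (ltn_ord o).
  have h2 := sep _ _ (fsym sbc) o (ltn_ord o).
  rewrite !embE in h1 h2; nia.
have := leq_card F F_inj; rewrite !card_ffun !card_ord.
apply/negP; rewrite -ltnNge.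
have h : ((2 * L).+1 <= E * N.+1)%N by rewrite /L /E; nia.
have mono m n e : (m <= n -> m ^ e <= n ^ e)%N.
  by move=> mn; case: e => // e; rewrite leq_exp2r.
apply: (@leq_ltn_trans ((E * N.+1) ^ #|T|)%N); first exact: mono.
apply: (@leq_trans (N.+1 ^ #|T|.+1)%N); last exact: leq_pexp2l.
by rewrite expnMn expnS ltn_mul2r expn_gt0 /= ltnS.
Qed.

Section Spread.
Variable R : realType.

(** A coarse form of growth of degree at least j.  Parameters are sequences of
    which only the first j terms matter for the separation. *)
Definition spread (X : metricType R) (j : nat) : Prop :=
  exists (s : (nat -> nat) -> X) (x0 : X) (C : R),
  [/\ 0 <= C,
    forall a N, (forall i, (a i <= N)%N) -> mdist (s a) x0 <= C * N.+1%:R &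
    forall a b i, (i < j)%N ->
      `|(a i)%:R - (b i)%:R| <= C * (mdist (s a) (s b) + 1)].

(** Choose for every y a point whose image is within A of it. *)
Lemma quasi_inverse (X Y : metricType R) (f : X -> Y) :
  quasi_isometry f -> exists g : Y -> X, quasi_isometry g.
Proof.
move=> [K [A [K1 A0 fKA fsurj]]].
have /choice[g gP] : forall y, exists x, mdist (f x) y <= A by exact: fsurj.
have K0 : 0 < K by apply: lt_le_trans K1.
exists g; exists K, (K * (3 * A)); split=> //.
- by rewrite !mulr_ge0 // ltW.
- move=> x y; have /andP[h1 h2] := fKA (g x) (g y).
  have gx := gP x; have gy := gP y.
  have gx' := gP x; rewrite metric_sym in gx'.
  have gy' := gP y; rewrite metric_sym in gy'.
  have t1 := metric_triangle x (f (g x)) y.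
  have t2 := metric_triangle (f (g x)) (f (g y)) y.
  have t3 := metric_triangle (f (g x)) x (f (g y)).
  have t4 := metric_triangle x y (f (g y)).
  apply/andP; split.
    rewrite -(ler_pM2l K0) mulrBr mulVKf ?gt_eqF //.
    have : K * (3 * A) <= K * (K * (3 * A)).
      by rewrite ler_pM2l // ler_peMl // mulr_ge0.
    have : 3 * A <= K * (3 * A) by rewrite ler_peMl // mulr_ge0.
    lra.
  rewrite -mulrDr -(ler_pM2l (_ : 0 < K^-1)) ?invr_gt0 // mulKf ?gt_eqF //.
  lra.
- move=> x; exists (f x); have /andP[h1 _] := fKA (g (f x)) x.
  have := gP (f x) => h2.
  rewrite -(ler_pM2l (_ : 0 < K^-1)) ?invr_gt0 // mulKf ?gt_eqF //; lra.
Qed.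

Lemma spread_qi (X Y : metricType R) (f : X -> Y) j :
  quasi_isometry f -> spread X j -> spread Y j.
Proof.
move=> [K [A [K1 A0 fKA _]]] [s [x0 [C [C0 sC sep]]]].
have K0 : 0 < K by apply: lt_le_trans K1.
pose C' := K * C + A + C * (K + K * A + 1).
have KA : 0 <= K * A by rewrite mulr_ge0 // ltW.
have KC : 0 <= K * C by rewrite mulr_ge0 // ltW.
have CK : 0 <= C * (K + K * A + 1) by rewrite mulr_ge0 //; lra.
exists (f \o s), (f x0), C'; split => [|a N aN|a b i ij] /=.
- by rewrite /C'; lra.
- have /andP[_ h] := fKA (s a) x0; apply: le_trans h _.
  have hs := sC a N aN.
  have : K * mdist (s a) x0 <= K * (C * N.+1%:R) by rewrite ler_pM2l.
  have : A <= A * N.+1%:R by rewrite ler_peMr // ler1n.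
  have : 0 <= C * (K + K * A + 1) * N.+1%:R by rewrite mulr_ge0.
  rewrite /C' !mulrDl; lra.
- apply: le_trans (sep a b i ij) _.
  have /andP[h _] := fKA (s a) (s b).
  have d0 := mdist_ge0 (f (s a)) (f (s b)).
  apply: (@le_trans _ _ (C * ((K + K * A + 1) * (mdist (f (s a)) (f (s b)) + 1)))).
    apply: ler_wpM2l => //.
    have : mdist (s a) (s b) <= K * (mdist (f (s a)) (f (s b)) + A).
      by rewrite -(ler_pM2l (_ : 0 < K^-1)) ?invr_gt0 // mulKf ?gt_eqF //; lra.
    have : 0 <= K * A * mdist (f (s a)) (f (s b)) by rewrite mulr_ge0.
    lra.
  by rewrite mulrA; apply: ler_wpM2r; rewrite /C'; lra.
Qed.

Lemma spread_complete (G : sgraph) : complete G -> spread (salvetti R G) #|G|.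
Proof.
move=> cG; pose s (a : nat -> nat) := point_of cG (fun v => (a (enum_rank v))%:R : R).
exists s, (point_of cG (fun=> 0)), (1 + 4 * #|G|%:R); split => [|a N aN|a b i iG].
- by rewrite addr_ge0 // mulr_ge0.
- apply: le_trans (sdist_le_pos cG _ _) _.
  apply: (@le_trans _ _ (\sum_(v : G) N%:R + (3 * #|G|)%:R)).
    rewrite lerD2r; apply: ler_sum => v _.
    by rewrite !pos_point subr0 ger0_norm // ler_nat.
  rewrite sumr_const natrM -mulr_natr -natr1.
  have : 0 <= N%:R * #|G|%:R :> R by rewrite mulr_ge0.
  by have : 0 <= N%:R :> R by []; have : 0 <= #|G|%:R :> R by []; lra.
- have := pos_lip (s a) (s b) (enum_val (Ordinal iG)).
  rewrite !pos_point enum_valK /= => h; apply: le_trans h _.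
  change (sdist (s a) (s b) <= (1 + 4 * #|G|%:R) * (sdist (s a) (s b) + 1)).
  have d0 := sdist_ge0 (s a) (s b).
  have : 0 <= 4 * #|G|%:R * (sdist (s a) (s b) + 1) by rewrite mulr_ge0 //; lra.
  lra.
Qed.

Lemma spread_incomplete (H : sgraph) j : ~ complete H -> spread (salvetti R H) j.
Proof.
move=> /existsNP[v /existsNP[w /not_implyP[vw /negP nvw]]].
pose s (a : nat -> nat) := vertex_pt R (track v w a j).
exists s, (vertex_pt R (1%g : raag H)), (1 + j%:R); split => [|a N aN|a b i ij].
- by rewrite addr_ge0.
- apply: le_trans (sdist_track v w R a j) _.
  rewrite nat1r -natrM ler_nat.
  have : (\sum_(0 <= i < j) a i <= j * N)%N.
    by rewrite -[j in (j * _)%N]subn0 -sum_nat_const_nat leq_sum.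
  nia.
- have := lamp_lip vw nvw R i (track v w a j) (track v w b j).
  rewrite !lamp_track // ij /= intrB => h; apply: le_trans h _.
  have d0 := sdist_ge0 (s a) (s b).
  change (sdist (s a) (s b) <= (1 + j%:R) * (sdist (s a) (s b) + 1)).
  have : 0 <= j%:R * (sdist (s a) (s b) + 1) by rewrite mulr_ge0 //; lra.
  lra.
Qed.

(** Rounded coordinates map the family to Z^G; two members with the same
    rounded coordinates are at bounded distance, so have close parameters. *)
Lemma spread_le_card (G : sgraph) j :
  complete G -> spread (salvetti R G) j -> (j <= #|G|)%N.
Proof.
move=> cG [s [x0 [C [C0 sC sep]]]].
pose B := C + 1 + \sum_v `|pos x0 v|.
have S0 : 0 <= \sum_v `|pos x0 v| by exact: sumr_ge0.
have B0 : 0 <= B by rewrite /B; lra.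
pose D := C * (4 * #|G|%:R + 1).
have D0 : 0 <= D by rewrite mulr_ge0 // addr_ge0 // mulr_ge0.
apply: (@lattice_dim G j (Num.bound B) (Num.bound D)
  (fun a v => exponent v (base (s a)))) => [a N aN v|a b ab i ij].
  rewrite -(ler_nat R) natrM natr_absz intr_norm.
  apply: (@le_trans _ _ (B * N.+1%:R)); last first.
    by rewrite ler_wpM2r // ltW // archi_boundP.
  have h := le_trans (pos_lip (s a) x0 v) (sC a N aN).
  have hv : `|pos x0 v| <= \sum_v `|pos x0 v|.
    by rewrite (bigD1 v) //= lerDl sumr_ge0.
  have /andP[c0 c1] := coordP (s a) v.
  have N1 : 1 <= N.+1%:R :> R by rewrite ler1n.
  have : \sum_v `|pos x0 v| <= (\sum_v `|pos x0 v|) * N.+1%:R by rewrite ler_peMr.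
  have := ler_norm (pos x0 v); have := ler_norm (- pos x0 v); rewrite normrN.
  move: h; rewrite /pos -/(pos x0 v) /B !mulrDl mul1r !ler_norml; lra.
have dab : mdist (s a) (s b) <= 4 * #|G|%:R.
  apply: le_trans (sdist_le_pos cG _ _) _.
  have -> : 4 * #|G|%:R = \sum_(v : G) 1 + (3 * #|G|)%:R :> R.
    by rewrite sumr_const natrM; lra.
  rewrite lerD2r; apply: ler_sum => v _; rewrite /pos ab.
  have := coordP (s a) v; have := coordP (s b) v.
  by rewrite ler_norml; lra.
have h : (a i)%:R - (b i)%:R <= D.
  apply: le_trans (ler_norm _) (le_trans (sep a b i ij) _).
  by rewrite ler_wpM2l // lerD2r.
have := archi_boundP D0.
rewrite -(ler_nat R) natrD; lra.
Qed.

Lemma qi_complete (G H : sgraph) (f : salvetti R G -> salvetti R H) :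
  complete G -> quasi_isometry f -> complete H /\ #|G| = #|H|.
Proof.
move=> cG qf; have [g qg] := quasi_inverse qf.
have cH : complete H.
  apply: contrapT => nH.
  have := spread_le_card cG (spread_qi qg (spread_incomplete #|G|.+1 nH)).
  by rewrite ltnn.
split=> //; apply/eqP; rewrite eqn_leq; apply/andP; split.
  exact: (spread_le_card cH (spread_qi qf (spread_complete cG))).
exact: (spread_le_card cG (spread_qi qg (spread_complete cH))).
Qed.

End Spread.

(** * The dovetail property *)

Lemma extend_to_bijection (T U : finType) (D : {set T}) (f : T -> U) :
  #|T| = #|U| -> {in D &, injective f} ->
  exists2 s : T -> U, bijective s & {in D, s =1 f}.
Proof.
move=> TU; have [n] := ubnP #|~: D|%SET.
elim: n D f => // n IH D f Dn injf.
have [DT|] := eqVneq (~: D)%SET finset.set0.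
  exists f => //; apply: inj_card_bij; last by rewrite TU.
  have inD x : x \in D by rewrite -[D]finset.setCK DT finset.setC0 finset.in_setT.
  by move=> x y; apply: injf.
move=> /set0Pn[x]; rewrite finset.in_setC => xD.
have [y yD] : exists y, y \notin (f @: D)%SET.
  apply/existsP; rewrite -negb_forall; apply/negP => /forallP all.
  have : (#|U| <= #|D|)%N.
    apply: leq_trans (leq_imset_card f D).
    by apply/subset_leq_card/fintype.subsetP => y _; exact: all.
  rewrite -TU -(cardsC D) -{2}[#|D|]addn0 leq_add2l leqn0 cards_eq0.
  by apply/negP/set0Pn; exists x; rewrite finset.in_setC.
pose f' z := if z == x then y else f z.
have f'D z : z \in D -> f' z = f z.
  by move=> zD; rewrite /f' ifN //; apply: contraNneq xD => <-.
have f'y z : z \in D -> f z <> y.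
  by move=> zD fz; move: yD; rewrite -fz imset_f.
have [||s bs sf] := IH (x |: D)%SET f'.
- rewrite -ltnS; apply: leq_trans Dn; rewrite ltnS.
  apply: proper_card; rewrite properE !finset.setCS finset.subsetUr /=.
  apply/negP => /fintype.subsetP/(_ x); rewrite !inE eqxx (negbTE xD).
  by move=> /(_ isT).
- move=> a b; rewrite !inE => /orP[/eqP->|aD] /orP[/eqP->|bD] //.
  + by rewrite (f'D b) // {1}/f' eqxx => /esym/(f'y b bD).
  + by rewrite (f'D a) // {1}/f' eqxx => /(f'y a aD).
  + by rewrite !f'D //; exact: injf.
by exists s => // z zD; rewrite sf ?f'D // !inE zD orbT.
Qed.

Section QuasiIsometryImages.
Variables (R : realType) (X Y : metricType R) (f : X -> Y).
Hypothesis qf : quasi_isometry f.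

Lemma qi_dHaus_fin (A B : set X) :
  (dHaus (f @` A) (f @` B) < +oo)%E <-> (dHaus A B < +oo)%E.
Proof.
have [K [a [K1 a0 fKa _]]] := qf.
have K0 : 0 < K by apply: lt_le_trans K1.
split=> /dHaus_finP[e [e0 AB BA]]; apply/dHaus_finP.
  have H (P Q : set X) : f @` P `<=` nbhd e (f @` Q) -> P `<=` nbhd (K * (e + a)) Q.
    move=> PQ x Px; have [|_ [y Qy <-] xy] := PQ (f x); first by exists x.
    exists y => //; have /andP[h _] := fKa x y.
    by rewrite -(ler_pM2l (_ : 0 < K^-1)) ?invr_gt0 // mulKf ?gt_eqF //; lra.
  by exists (K * (e + a)); split; [rewrite mulr_ge0 ?addr_ge0 // ltW|exact: H|exact: H].
have H (P Q : set X) : P `<=` nbhd e Q -> f @` P `<=` nbhd (K * e + a) (f @` Q).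
  move=> PQ _ [x Px <-]; have [y Qy xy] := PQ x Px.
  exists (f y); first by exists y.
  have /andP[_ h] := fKa x y; apply: le_trans h _.
  by rewrite lerD2r ler_pM2l.
by exists (K * e + a); split; [rewrite addr_ge0 ?mulr_ge0 // ltW|exact: H|exact: H].
Qed.

End QuasiIsometryImages.

(** The map on labels induced by f_* extends to the label w0 of l.  Indeed the
    image under f of a line labelled w in B_G is close to lines labelled tau w,
    and f(l) is close to l', so that tau w is the label of l' exactly when
    w = w0. *)
Lemma complete_dovetail (R : realType) (G : sgraph) : complete G -> dovetail R G.
Proof.
move=> cG H BG BH O dG dH l l' f fs lambda _ _ [w0 wl] [u0 ul'].
move=> [[bfs [K [A [qfKA fsF]]]] dGH ll'] lam0 _ _.
have qf : quasi_isometry f by exists K, A.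
have [cH GH] := qi_complete cG qf.
have pG w : w \in BG -> peripheral R BG (@line_class R G w).
  by move=> wB; apply/peripheralP => //; exists w.
have /choice[tau tauP] : forall w, exists u, w \in BG ->
    u \in BH /\ fs (@line_class R G w) = @line_class R H u.
  move=> w; have [wB|_] := boolP (w \in BG); last by exists u0.
  case: bfs => fsQ _ _; have /(peripheralP cH)[u uB ue] := fsQ _ (pG w wB).
  by exists u.
have tau_base w : w \in BG -> tau w = u0 <-> w = w0.
  move=> wB; have [uB fsw] := tauP w wB.
  have w1 : labelled w (std_line 1%g w : set (salvetti R G)) by exists 1%g.
  have [b] := (fsF _ (pG w wB)).1 _ w1; rewrite fsw => ub /dHaus_fin fb.
  have fl : (dHaus (f @` l) l' < +oo)%E by apply/coarse_classP.
  split=> [/(labelled_dHaus_fin cH ub ul') bl'|/(labelled_dHaus_fin cG w1 wl)].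
    apply/(labelled_dHaus_fin cG w1 wl)/(qi_dHaus_fin qf).
    apply: dHaus_fin_trans fb (dHaus_fin_trans bl' _); exact: dHaus_fin_sym.
  move=> /(qi_dHaus_fin qf) wfl; apply/(labelled_dHaus_fin cH ub ul').
  apply: dHaus_fin_trans (dHaus_fin_sym fb) _; exact: dHaus_fin_trans wfl fl.
(* The default value is used at w0 only, when w0 is not in BG. *)
pose tau' w := if w \in BG then tau w else u0.
have tau'w0 : tau' w0 = u0.
  by rewrite /tau'; case: ifP => // wB; apply/tau_base.
have tau'_base w : w \in BG -> tau' w = u0 -> w = w0.
  by move=> wB; rewrite /tau' wB => /tau_base; exact.
have tau'_inj : {in (w0 |: BG)%SET &, injective tau'}.
  move=> a b; rewrite !inE => /orP[/eqP->|aB] /orP[/eqP->|bB] //.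
  - by rewrite tau'w0 => /esym/tau'_base ->.
  - by rewrite tau'w0 => /tau'_base ->.
  rewrite /tau' aB bB => ab; apply: (line_class_inj cG (R := R)).
  case: bfs => _ fs_inj _; apply: fs_inj; rewrite ?inE; [exact: pG|exact: pG|].
  by rewrite (tauP a aB).2 (tauP b bB).2 ab.
have [s [t sK tK] sE] := extend_to_bijection GH tau'_inj.
have sw0 : s w0 = u0 by rewrite sE ?tau'w0 // !inE eqxx.
have fss w : w \in BG -> fs (@line_class R G w) = @line_class R H (s w).
  by move=> wB; rewrite sE /tau' ?wB ?(tauP w wB).2 // !inE wB orbT.
pose lam w : R := if w \in BG then ratr (lambda (@line_class R G w)) else 1.
have lam_gt0 w : 0 < lam w.
  by rewrite /lam; case: ifP => // wB; rewrite ltr0q lam0 //; exact: pG.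
have near g w : (dHaus (stretch cH t lam @` std_line g w)
    (image_line s t lam g w) < +oo)%E.
  exact: dHaus_fin (dHaus_image_line cG cH sK tK lam_gt0 g w).
exists (5 * #|H|%:R), (stretch cH t lam), fs; split.
- split=> //.
    apply: (stretch_relative cG cH sK tK lam_gt0) => // F.
    by move=> /(peripheralP cG)[w wB ->]; exists w; rewrite ?fss.
  apply/coarse_classP; have [g lE] := wl; rewrite lE.
  apply: dHaus_fin_trans (near g w0) _.
  by apply/(labelled_dHaus_fin cH _ ul' (w := s w0)) => //; eexists.
- move=> w k wB wk _; rewrite (parallel_classE cG wk); have [g ->] := wk.
  exists (image_line s t lam g w); split.
  + by exists (s w); eexists.
  + exact/coarse_classP.
  + apply: stretch_str => //; first by rewrite /lam wB.
    by apply: lam0; exact: pG.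
- move=> w k _ wk Rk; have [_ []] := complete_F_geodesic cG Rk.1; exact: Rk.
Qed.

Theorem proposition6p21 (R : realType) (n : nat) :
  free_abelian_of_rank n (raag (complete_graph n)) /\
  (forall G : sgraph, free_abelian_of_rank n (raag G) ->
    dovetail R G /\
    forall l : set (salvetti R G), std_geodesic l -> F_geodesic l).
Proof.
split=> [|G /free_abelian_complete cG]; first exact: raag_complete_free_abelian.
by split=> [|l]; [exact: complete_dovetail|exact: complete_F_geodesic].
Qed.
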